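(* Let $E=[1/2,1]$. For a.e. $x\in[0,1]$, the coefficients $\{d_j(x)\}$ of the backward continued fraction expansion $$x=1-\cfrac{1}{d_1-\cfrac{1}{d_2-\dots}},\qquad d_j\in\mathbb{N}_{\ge 2},$$ satisfy $$\lim_{N\to\infty}\frac1N\left(\sum_{j=1}^{N+m(N,E,x)}d_j(x)-\max\left\{2\,m(N,E,x),\ \max_{1\le k\le N+m(N,E,x)}d_k(x)\right\}\right)=3.$$
   Context: The Backward Continued Fraction transformation is $T_{BCF}:[0,1]\to[0,1]$, $T_{BCF}(x)=\left\{\frac{1}{1-x}\right\}$, where $\{y\}=y \pmod 1$ is the fractional part. Every irrational $x\in[0,1]$ has a unique expansion of the displayed form, and $d_j(x)=\left\lfloor\frac{1}{1-T_{BCF}^{j-1}(x)}\right\rfloor+1$ for all $j\ge 1$. ''A.e.'' refers to Lebesgue measure on $[0,1]$ (equivalently, to the infinite $T_{BCF}$-invariant measure with density $\frac{1}{x\log 2}$). With $T=T_{BCF}$, the longest excursion out of $E$ beginning in the first $N$ steps is (for a.e. $x$) $$m(N,E,x)=1+\max\{k\ge 1:\exists\,\ell\in\{1,\dots,N+1\}\text{ s.t. }T^{\ell+j}(x)\notin E,\ \forall j=0,\dots,k-1\}.$$ *)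

(* Defs.v *)
From HB Require Import structures.
From mathcomp Require Import all_boot all_order all_algebra.
From mathcomp Require Import all_classical all_reals all_analysis.

Set Implicit Arguments.
Unset Strict Implicit.
Unset Printing Implicit Defensive.

Import Order.TTheory GRing.Theory Num.Theory.
Import numFieldNormedType.Exports.

Local Open Scope classical_set_scope.
Local Open Scope ring_scope.

Definition frac (R : realType) (y : R) : R := y - (Num.floor y)%:~R.

(* The map of [0, 1], as a function on R; since 0^-1 = 0, the point 1, where
   1 / (1 - x) makes no sense, is sent to 0. *)
Definition T_BCF (R : realType) (x : R) : R := frac (1 / (1 - x)).

(* Digits are numbered from j = 1. On [0, 1] the argument of Num.truncn is
   nonnegative, so that Num.truncn is the floor. *)
Definition bcf_digit (R : realType) (x : R) (j : nat) : nat :=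
  (Num.truncn (1 / (1 - iter j.-1 (@T_BCF R) x))).+1.

(* 1 / (d_j - 1 / (d_{j+1} - ... - 1 / d_{j+n-1})), with n levels. *)
Fixpoint bcf_tail (R : realType) (d : nat -> nat) (j n : nat) : R :=
  if n is n'.+1 then 1 / ((d j)%:R - bcf_tail R d j.+1 n') else 0.

(* x = 1 - 1 / (d_1 - 1 / (d_2 - ...)) with all d_j >= 2. *)
Definition is_bcf_expansion (R : realType) (d : nat -> nat) (x : R) : Prop :=
  (forall j, (1 <= j)%N -> (2 <= d j)%N) /\
  (fun n => 1 - bcf_tail R d 1 n) @ \oo --> x.

(* 0 when A has no greatest element, i.e. when A is empty or unbounded. *)
Definition max_nat (A : set nat) : nat :=
  xget 0%N [set k | A k /\ forall i, A i -> (i <= k)%N].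

(* For T = T_BCF and E = [1/2, 1] the set of lengths is bounded for every N,
   and nonempty for all large N, for almost every x. *)
Definition longest_excursion (X : Type) (T : X -> X) (N : nat) (E : set X)
    (x : X) : nat :=
  (1 + max_nat [set k | (1 <= k)%N /\
         exists l, (1 <= l <= N.+1)%N /\
           forall j, (j < k)%N -> ~ E (iter (l + j) T x)])%N.

(* Main.v *)
Require Import Defs.
From HB Require Import structures.
From mathcomp Require Import all_boot all_order all_algebra.
From mathcomp Require Import all_classical all_reals all_analysis.
From mathcomp Require Import ring lra zify.

Set Implicit Arguments.
Unset Strict Implicit.
Unset Printing Implicit Defensive.

Import Order.TTheory GRing.Theory Num.Theory.
Import numFieldNormedType.Exports.
Local Open Scope classical_set_scope.
Local Open Scope ring_scope.

(** Put y = 1 - x, let G be the Gauss map z |-> {1/z}, and let z = G y, with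
    regular continued fraction digits a_0, a_1, ...  The first step of T_BCF
    sends x to z, and from there T_BCF is a slowed-down version of G: while
    1/v > 2 it only replaces 1/v by 1/v - 1 (digit 2, outside [1/2, 1]), and
    once 1/v = 1 + g it jumps to G g (inside [1/2, 1], with digit equal to the
    regular digit of g, plus 2). Hence the orbit of z splits into blocks: the
    n-th block has a_(2n) steps, of which all but the last have digit 2, and
    the last one has digit a_(2n+1) + 2 (orbit_in_block). The even digits
    measure time and excursions, the odd digits carry the excess of the sum
    over 2 per step. In particular m(N) is exactly the largest a_(2n) over the
    blocks begun by time N (longest_excursionE).

    The sum of the digits of a typical point up to n is not well approximated
    by its mean, because a single huge digit may dominate; but once the largest
    digit is removed it is (Khinchin, Diamond and Vaaler). The quantity that is
    subtracted in the statement removes exactly that digit, be it an even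
    one (which contributes an excursion of length m, i.e. 2m to the sum) or an
    odd one (which is itself the largest backward digit). What remains is
    2 N + (trimmed odd sum), while N is, up to a negligible error, the trimmed
    even sum; and the trimmed even and odd sums are asymptotically equal. This
    gives 2 + 1 = 3.

    Two facts about almost every digit sequence are therefore needed
    (typical_digits). At the scale n ~ 2^j let M_j = 2^j j^(2/3) be a truncation
    level. First, at most one digit of index O(n) exceeds M_j. Second, the
    partial sums of the even and of the odd digits truncated at M_j stay close
    to n times a common mean pi_j, within a small multiple of n pi_j, where
    pi_j >= j/6. Since M_j / (n pi_j) tends to 0, truncation is harmless for all
    digits but one. Deterministic counting along blocks (even_window,
    odd_window, typical_balance) then gives the limit.

    Both facts come from the Markov structure of the digits. Given the past,
    the next digit has a law depending only on the ratio s = q'/q of successive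
    denominators: it is k+1 with probability (1+s)/((k+1+s)(k+2+s)), and s
    becomes 1/(k+1+s). So the measure of an event depending on finitely many
    digits can be bounded by induction, one digit at a time (law_le_step). For
    large digits this gives independence-like bounds (digit_count_le), with
    probability O(j^(-4/3)) for two large ones. For the partial sums, the
    averaging operator of the chain s contracts Lipschitz constants by 11/12
    (transfer_lipschitz), so the conditional expectations of later truncated
    digits converge geometrically to pi_j. Adding to the partial sum the
    expected value of its remaining part turns it into a martingale with
    increments of variance O(M_j + pi_j^2), and the maximal inequality for it,
    also proved by induction over digits (exceeds_law_le), bounds the
    probability of a deviation by O(j^(-4/3) + 2^(-j)). Both series converge
    and the Borel-Cantelli argument (limsup_negligible) concludes. *)

(** * Outer measure and null sets *)

(** On non-measurable sets the value of lebesgue_measure is the outer measure, so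
    monotonicity and countable subadditivity hold for all sets. The exceptional
    sets below are handled through upper bounds on this outer measure. *)
Lemma lebesgue_outer_le (R : realType) (A B : set R) :
  A `<=` B -> (lebesgue_measure A <= lebesgue_measure B)%E.
Proof. exact: (le_outer_measure (@lebesgue_measure R)). Qed.

Lemma lebesgue_outer_bigcup (R : realType) (A : nat -> set R) (e : nat -> R)
    (c : R) :
  (forall k, (lebesgue_measure (A k) <= (e k)%:E)%E) ->
  (forall n, \sum_(k < n) e k <= c) ->
  (lebesgue_measure (\bigcup_k A k) <= c%:E)%E.
Proof.
move=> Ae ec.
apply: (@le_trans _ _ (\sum_(0 <= k <oo) lebesgue_measure (A k))%E).
  exact: (outer_measure_sigma_subadditive (@lebesgue_measure R) A).
have m0 k : (0 <= lebesgue_measure (A k))%E.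
  exact: (outer_measure_ge0 (@lebesgue_measure R) (A k)).
apply: lime_le.
  by apply: is_cvg_nneseries => k _ _; exact: m0.
apply: nearW => n.
apply: (@le_trans _ _ (\sum_(k < n) (e k))%:E); last by rewrite lee_fin.
rewrite big_mkord -sumEFin; apply: lee_sum => k _; exact: Ae.
Qed.

Lemma negligible_le (R : realType) (A : set R) :
  (forall e : R, 0 < e -> (lebesgue_measure A <= e%:E)%E) ->
  (@lebesgue_measure R).-negligible A.
Proof.
move=> Ae; apply/negligible_outer_measure; apply/eqP.
rewrite eq_le [X in _ && X]outer_measure_ge0 andbT.
by apply/lee_addgt0Pr => e e0; rewrite add0e; exact: Ae.
Qed.

(** Borel-Cantelli: the tails of a bounded series of nonnegative terms are small. *)
Lemma limsup_negligible (R : realType) (A : nat -> set R) (e : nat -> R)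
    (c : R) :
  (forall j, (lebesgue_measure (A j) <= (e j)%:E)%E) ->
  (forall n, \sum_(j < n) e j <= c) ->
  (@lebesgue_measure R).-negligible
    [set x | forall J, exists2 j, (J <= j)%N & A j x].
Proof.
move=> Ae ec; apply: negligible_le => eps eps0.
have e0 j : 0 <= e j.
  rewrite -lee_fin; apply: le_trans (Ae j).
  exact: (outer_measure_ge0 (@lebesgue_measure R) (A j)).
pose u n := \sum_(j < n) e j.
have [J uJ] : exists J, forall n, u n <= u J + eps.
  have hs : has_sup (range u).
    split; first by exists (u 0%N), 0%N.
    by exists c => _ [n _ <-]; exact: ec.
  have [_ [J _ <-] uJ] := sup_adherent eps0 hs.
  exists J => n; rewrite -lerBlDr (le_trans _ (ltW uJ))// lerD2r.
  by apply: ub_le_sup; [exact: hs.2|exists n].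
apply: (@le_trans _ _ (lebesgue_measure (\bigcup_j A (J + j)%N))).
  apply: lebesgue_outer_le => x /(_ J)[j Jj Ax].
  by exists (j - J)%N => //; rewrite subnKC.
apply: (@lebesgue_outer_bigcup _ _ (fun j => e (J + j)%N)) => [j|n].
  exact: Ae.
rewrite -(lerD2l (u J)); apply: le_trans (uJ (J + n)%N).
by rewrite /u big_split_ord.
Qed.

(** * Regular continued fraction digits and the law of the next digit *)

Definition irr01 (R : realType) : set R :=
  [set z | 0 < z < 1 /\ irrational z].

Definition gauss_digit (R : realType) (z : R) : nat := Num.truncn z^-1.

Definition gauss_map (R : realType) (z : R) : R := z^-1 - (gauss_digit z)%:R.

Definition gauss_seq (R : realType) (z : R) (i : nat) : nat :=
  gauss_digit (iter i (@gauss_map R) z).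

Definition scons (k : nat) (a : nat -> nat) (i : nat) : nat :=
  if i is i'.+1 then a i' else k.

Lemma irrationalV (R : realType) (z : R) : irrational z -> irrational z^-1.
Proof.
by move=> zi [q _ qz]; apply: zi; exists q^-1; rewrite // fmorphV /= qz invrK.
Qed.

Lemma irrationalBn (R : realType) (z : R) (n : nat) :
  irrational z -> irrational (z - n%:R).
Proof.
move=> zi [q _ qz]; apply: zi; exists (q + n%:R) => //.
by rewrite rmorphD /= qz ratr_nat subrK.
Qed.

(** The left inequality is strict because z is irrational; this is why every
    iterate of the Gauss map remains in the open interval. *)
Lemma gauss_digit_itv (R : realType) (z : R) : irr01 z ->
  (gauss_digit z)%:R < z^-1 < (gauss_digit z).+1%:R.
Proof.
move=> [/andP[z0 z1] zi].
have := @truncn_itv R z^-1; rewrite invr_ge0 (ltW z0) => /(_ isT)/andP[le1 ->].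
rewrite andbT lt_neqAle le1 andbT; apply/eqP => kz.
apply: (irrationalV zi); exists (gauss_digit z)%:R => //.
by rewrite ratr_nat.
Qed.

Lemma gauss_digit_gt0 (R : realType) (z : R) : irr01 z ->
  (0 < gauss_digit z)%N.
Proof.
move=> zi; have [/andP[z0 z1] _] := zi.
have /andP[_ hz] := gauss_digit_itv zi.
have : 1 < z^-1 by rewrite invf_gt1.
by case: (gauss_digit z) hz => // h /(lt_trans h); rewrite ltxx.
Qed.

Lemma gauss_map_irr (R : realType) (z : R) : irr01 z -> irr01 (gauss_map z).
Proof.
move=> zi; split; last by apply/irrationalBn/irrationalV; case: zi.
have := gauss_digit_itv zi; rewrite -natr1 /gauss_map; lra.
Qed.

Lemma gauss_mapK (R : realType) (z : R) :
  ((gauss_digit z)%:R + gauss_map z)^-1 = z.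
Proof. by rewrite /gauss_map addrC subrK invrK. Qed.

Lemma iter_gauss_irr (R : realType) (z : R) i :
  irr01 z -> irr01 (iter i (@gauss_map R) z).
Proof. by move=> zi; elim: i => //= i; exact: gauss_map_irr. Qed.

Lemma gauss_seqS (R : realType) (z : R) i :
  gauss_seq z i.+1 = gauss_seq (gauss_map z) i.
Proof. by rewrite /gauss_seq iterSr. Qed.

Lemma gauss_seq_cons (R : realType) (z : R) : irr01 z ->
  gauss_seq z = scons (gauss_digit z) (gauss_seq (gauss_map z)).
Proof. by move=> zi; apply/funext => -[|i]//=; rewrite gauss_seqS. Qed.

Definition mobius (R : realType) (p p' q q' z : R) : R :=
  (p + p' * z) / (q + q' * z).

Definition digit_pr (R : realType) (s : R) (k : nat) : R :=
  (1 + s) / ((k.+1%:R + s) * (k.+2%:R + s)).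

Definition next_state (R : realType) (s : R) (k : nat) : R := (k.+1%:R + s)^-1.

(** Bounds by e the probability of S under the law of the future digits of a random
    point whose past digits have convergents p/q and p'/q' (last and last but one). The Moebius
    map is the inverse branch of the iterated Gauss map determined by this past;
    its image of ]0, 1[ is the cylinder of that past, of length 1/(q(q+q')), and
    the conditional law depends on the past through s = q'/q only. The quantifier
    over all branches with the same s is what makes induction over digits work;
    with p' = -1 and p = q = 1 it also covers the reflection z |-> 1 - z. *)
Definition law_le (R : realType) (s : R) (S : set (nat -> nat)) (e : R) :=
  forall p p' q q' : R, 0 < q -> q' = s * q -> `|p' * q - p * q'| = 1 ->
  (lebesgue_measure
    (mobius p p' q q' @` [set z | irr01 z /\ S (gauss_seq z)])
     <= (e / (q * (q + q')))%:E)%E.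

Lemma next_itv (R : realType) (s : R) k : 0 <= s <= 1 ->
  0 <= next_state s k <= 1.
Proof.
move=> /andP[s0 s1]; have k1 : (1 : R) <= k.+1%:R by rewrite ler1n.
rewrite /next_state invr_ge0 invf_le1; lra.
Qed.

(** Total probability over the first digit: the cylinder is the union of its
    subcylinders, and the relative length of the k-th one is digit_pr s k. Indices
    are shifted by one: k stands for the digit k.+1. *)
Lemma law_le_step (R : realType) (s : R) S (e : nat -> R) (c : R) :
  0 <= s <= 1 ->
  (forall k, law_le (next_state s k) [set a | S (scons k.+1 a)] (e k)) ->
  (forall n, \sum_(k < n) digit_pr s k * e k <= c) ->
  law_le s S c.
Proof.
move=> /andP[s0 s1] Se ec p p' q q' q0 q'E det.
pose Q k := q * k.+1%:R + q'; pose P k := p * k.+1%:R + p'.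
have Q0 k : 0 < Q k.
  rewrite /Q q'E; have : 0 < k.+1%:R :> R by rewrite ltr0n.
  move=> k0; have : 0 < q * k.+1%:R by rewrite mulr_gt0.
  have : 0 <= s * q by rewrite mulr_ge0// ltW.
  lra.
(* The branch of the past extended by k.+1, from the recurrence of convergents. *)
pose A k := mobius (P k) p (Q k) q @`
  [set z | irr01 z /\ S (scons k.+1 (gauss_seq z))].
apply: (@le_trans _ _ (lebesgue_measure (\bigcup_k A k))).
  apply: lebesgue_outer_le => _ [z [zi Sz] <-].
  exists (gauss_digit z).-1 => //.
  exists (gauss_map z).
    by split; rewrite ?prednK ?gauss_digit_gt0 -?gauss_seq_cons//;
      exact: gauss_map_irr.
  have gi := gauss_map_irr zi.
  rewrite /P /Q prednK ?gauss_digit_gt0// -[in RHS](gauss_mapK z).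
  have d0 : (0 : R) <= (gauss_digit z)%:R by [].
  have g0 : 0 < gauss_map z by case: gi => /andP[].
  have h1 : 0 < (gauss_digit z)%:R + gauss_map z by lra.
  rewrite /mobius.
  set d := _%:R in d0 h1 *; set g := gauss_map z in gi g0 h1 *.
  have h2 : 0 < q * d + q' + q * g.
    by rewrite addrAC -mulrDr q'E ltr_wpDr ?mulr_gt0// mulr_ge0 ?(ltW q0).
  have -> : q + q' * (d + g)^-1 = (q * d + q' + q * g) / (d + g).
    by field; lra.
  have -> : p + p' * (d + g)^-1 = (p * d + p' + p * g) / (d + g).
    by field; lra.
  by field; lra.
apply: (@lebesgue_outer_bigcup _ _ (fun k => e k / (Q k * (Q k + q)))).
  move=> k; apply: (Se k) => //.
    rewrite /next_state /Q q'E; field; have : 0 < k.+1%:R :> R by [].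
  lra.
  by rewrite -det distrC; congr `|_|; rewrite /P /Q; ring.
move=> n.
rewrite [leLHS](_ : _ = (\sum_(k < n) digit_pr s k * e k) / (q * (q + q'))).
  rewrite ler_pM2r// invr_gt0 mulr_gt0// q'E ltr_wpDr// mulr_ge0//.
  exact: ltW.
rewrite mulr_suml; apply: eq_bigr => k _.
rewrite /digit_pr /Q q'E -(natr1 k.+1).
have : 0 < k.+1%:R :> R by [].
set K := _%:R => K0.
have qK : 0 < q * K by rewrite mulr_gt0.
have sq : 0 <= s * q by rewrite mulr_ge0// ltW.
by field; do ?(apply/andP; split); apply: lt0r_neq0; lra.
Qed.

(** The image of ]0, 1[ lies in an interval with endpoints p/q and (p+p')/(q+q'),
    in the order given by the sign of the determinant. *)
Lemma law_le_all (R : realType) (s : R) S : 0 <= s <= 1 -> law_le s S 1.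
Proof.
move=> /andP[s0 s1] p p' q q' q0 q'E det.
have sq : 0 <= s * q by rewrite mulr_ge0// ltW.
have Q0 : 0 < q + q' by lra.
pose D := p' * q - p * q'.
have DE (z : R) : 0 < z < 1 ->
    mobius p p' q q' z = p / q + D * (z / (q * (q + q' * z))).
  move=> /andP[z0 z1].
  have : 0 <= s * q * z by rewrite mulr_ge0// ltW.
  by move=> sqz; rewrite /mobius /D q'E; field; apply/andP; split;
    apply: lt0r_neq0; lra.
pose l := 1 / (q * (q + q')).
have l0 : 0 <= l by rewrite /l divr_ge0// mulr_ge0// ltW.
have zl (z : R) : 0 < z < 1 -> 0 <= z / (q * (q + q' * z)) <= l.
  move=> /andP[z0 z1].
  have sqz : 0 <= s * q * z by rewrite mulr_ge0// ltW.
  have d0 : 0 < q + q' * z by rewrite q'E; lra.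
  rewrite divr_ge0 ?mulr_ge0 ?(ltW q0) ?(ltW z0) ?(ltW d0)//= /l.
  rewrite ler_pdivrMr ?mulr_gt0// mulrAC ler_pdivlMr ?mulr_gt0// mul1r.
  have : 0 <= q * q * (1 - z) by rewrite !mulr_ge0// ?ltW//; lra.
  nra.
pose a := if 0 <= D then p / q else p / q - l.
apply: (@le_trans _ _ (lebesgue_measure (`[a, a + l]%classic : set R))).
  apply: lebesgue_outer_le => _ [z [[z01 _] _] <-].
  rewrite /= in_itv /= DE//; move: (zl _ z01) => /andP[u0 ul].
  rewrite /a; move: det; rewrite -/D; case: (leP 0 D) => D0.
    by rewrite ger0_norm// => ->; lra.
  by rewrite ltr0_norm// => D1; have -> : D = -1; lra.
rewrite lebesgue_measure_itv /=; case: ifP => _; last by rewrite lee_fin.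
by rewrite -EFinB lee_fin addrAC subrr add0r.
Qed.

Lemma law_le_sub (R : realType) (s : R) (S S' : set (nat -> nat)) e :
  S `<=` S' -> law_le s S' e -> law_le s S e.
Proof.
move=> SS' S'e p p' q q' q0 q'E det; apply: le_trans (S'e _ _ _ _ q0 q'E det).
apply: lebesgue_outer_le => _ [z [zi Sz] <-]; exists z => //; split => //.
exact: SS'.
Qed.

Lemma law_le_set0 (R : realType) (s : R) (S : set (nat -> nat)) :
  (forall a, ~ S a) -> law_le s S 0.
Proof.
move=> S0 p p' q q' q0 q'E det; rewrite mul0r.
apply: (@le_trans _ _ (lebesgue_measure (set0 : set R))).
  by apply: lebesgue_outer_le => y [z [_ /S0]].
by rewrite measure0.
Qed.

Lemma law_le_reflect (R : realType) (S : set (nat -> nat)) (e : R) :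
  law_le 0 S e ->
  (lebesgue_measure
     [set x : R | irr01 (1 - x)%R /\ S (gauss_seq (1 - x)%R)] <= e%:E)%E.
Proof.
move=> /(_ 1 (-1) 1 0 ltr01 (esym (mul0r _))).
rewrite mulr0 mulr1 subr0 normrN1 => /(_ erefl); rewrite addr0 mulr1 divr1.
apply: le_trans; apply: lebesgue_outer_le => x [xi Sx].
by exists (1 - x) => //; rewrite /mobius; field.
Qed.

Lemma law_le_mono (R : realType) (s : R) S e e' : 0 <= s <= 1 -> e <= e' ->
  law_le s S e -> law_le s S e'.
Proof.
move=> /andP[s0 s1] ee' Se p p' q q' q0 q'E det.
apply: le_trans (Se _ _ _ _ q0 q'E det) _; rewrite lee_fin ler_wpM2r//.
by rewrite invr_ge0 mulr_ge0 ?addr_ge0 ?(ltW q0)// q'E mulr_ge0 ?(ltW q0).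
Qed.

(** * Averages over the next digit *)

Lemma digit_pr_ge0 (R : realType) (s : R) k : 0 <= s <= 1 -> 0 <= digit_pr s k.
Proof.
move=> /andP[s0 s1].
by apply: divr_ge0; [lra|apply: mulr_ge0; exact: addr_ge0 (ler0n _ _) s0].
Qed.

(** The probability that the next digit is at least k.+1. *)
Definition digit_tail (R : realType) (s : R) (k : nat) : R :=
  (1 + s) / (k.+1%:R + s).

Lemma digit_prE (R : realType) (s : R) k : 0 <= s <= 1 ->
  digit_pr s k = digit_tail s k - digit_tail s k.+1.
Proof.
move=> /andP[s0 s1]; rewrite /digit_pr /digit_tail -(natr1 k.+1).
have : 0 < k.+1%:R :> R by rewrite ltr0n.
by move=> k0; field; apply/andP; split; apply: lt0r_neq0; lra.
Qed.

Lemma digit_pr_sum (R : realType) (s : R) n : 0 <= s <= 1 ->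
  \sum_(k < n) digit_pr s k = 1 - digit_tail s n.
Proof.
move=> s01; elim: n => [|n IH].
  rewrite big_ord0 /digit_tail; move/andP: s01 => [s0 s1].
  by rewrite divff ?subrr//; apply: lt0r_neq0; lra.
by rewrite big_ord_recr /= IH (digit_prE n s01); ring.
Qed.

Lemma digit_tail_itv (R : realType) (s : R) n : 0 <= s <= 1 ->
  0 <= digit_tail s n <= 2 / n.+1%:R.
Proof.
move=> /andP[s0 s1]; rewrite /digit_tail (divr_ge0 _ (addr_ge0 (ler0n _ _) s0)) ?addr_ge0//=.
have n0 : 0 < n.+1%:R :> R by rewrite ltr0n.
by rewrite ler_pdivrMr ?ltr_wpDr// mulrAC ler_pdivlMr//; nra.
Qed.

(** The expectation of phi over the next digit, where phi k is the value at the
    digit k.+1. Only bounded phi are used, for which the series converges. *)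
Definition mean (R : realType) (s : R) (phi : nat -> R) : R :=
  limn (fun n => \sum_(k < n) digit_pr s k * phi k).

Section MeanTheory.
Context (R : realType).
Implicit Types (s c B : R) (phi psi : nat -> R).

Lemma partial_mean_le s phi B n : 0 <= s <= 1 -> 0 <= B ->
  (forall k, phi k <= B) ->
  \sum_(k < n) digit_pr s k * phi k <= B.
Proof.
move=> s01 B0 phiB.
apply: (@le_trans _ _ (\sum_(k < n) digit_pr s k * B)).
  by apply: ler_sum => k _; rewrite ler_wpM2l ?digit_pr_ge0.
rewrite -mulr_suml digit_pr_sum// ler_piMl//.
by have /andP[] := digit_tail_itv n s01; lra.
Qed.

Lemma mean_cvg s phi B : 0 <= s <= 1 -> (forall k, `|phi k| <= B) ->
  (fun n => \sum_(k < n) digit_pr s k * phi k) @ \oo --> mean s phi.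
Proof.
move=> s01 phiB.
have B0 : 0 <= B := le_trans (normr_ge0 _) (phiB 0%N).
have pos psi : (forall k, 0 <= psi k <= B + B) ->
    cvgn (fun n => \sum_(k < n) digit_pr s k * psi k).
  move=> psiB; apply: nondecreasing_is_cvgn.
    apply/nondecreasing_seqP => n; rewrite big_ord_recr /= lerDl.
    by rewrite mulr_ge0 ?digit_pr_ge0//; case/andP: (psiB n).
  exists (B + B) => _ [n _ <-].
  apply: partial_mean_le; rewrite ?addr_ge0// => k.
  by case/andP: (psiB k).
have c1 : cvgn (fun n => \sum_(k < n) digit_pr s k * (phi k + B)).
  by apply: (pos (fun k => phi k + B)) => k; have := phiB k; rewrite ler_norml; lra.
have c2 : cvgn (fun n => \sum_(k < n) digit_pr s k * B).
  by apply: (pos (fun=> B)) => k; lra.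
suff : cvgn (fun n => \sum_(k < n) digit_pr s k * phi k) by [].
rewrite [X in cvgn X](_ : _ = (fun n => \sum_(k < n) digit_pr s k * (phi k + B))
   - (fun n => \sum_(k < n) digit_pr s k * B)); first exact: is_cvgB.
apply/funext => n; rewrite fctE /= -sumrB; apply: eq_bigr => k _.
by rewrite mulrDr addrK.
Qed.

Lemma mean_cst s c : 0 <= s <= 1 -> mean s (fun=> c) = c.
Proof.
move=> s01; apply: cvg_lim => //.
rewrite [X in X @ \oo --> _](_ : _ = (fun n => c - c * digit_tail s n)).
  rewrite -[X in _ --> X]subr0; apply: cvgB; first exact: cvg_cst.
  rewrite -[X in _ --> X](mulr0 c); apply: cvgMl_tmp.
  apply: (@squeeze_cvgr _ _ _ _ (fun=> 0) (fun n => 2 * harmonic n)).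
  - by apply: nearW => n; exact: digit_tail_itv.
  - exact: cvg_cst.
  - rewrite -[X in _ --> X](mulr0 2); apply: cvgMl_tmp; exact: cvg_harmonic.
apply/funext => n; rewrite -mulr_suml digit_pr_sum//; ring.
Qed.

Lemma meanD s phi psi B C : 0 <= s <= 1 ->
  (forall k, `|phi k| <= B) -> (forall k, `|psi k| <= C) ->
  mean s (fun k => phi k + psi k) = mean s phi + mean s psi.
Proof.
move=> s01 hphi hpsi; apply: cvg_lim => //.
rewrite [X in X @ \oo --> _](_ : _ =
  (fun n => \sum_(k < n) digit_pr s k * phi k)
  + (fun n => \sum_(k < n) digit_pr s k * psi k)).
  by apply: cvgD; [exact: mean_cvg hphi|exact: mean_cvg hpsi].
apply/funext => n; rewrite fctE /= -big_split /=; apply: eq_bigr => k _.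
by rewrite mulrDr.
Qed.

Lemma meanZ s c phi B : 0 <= s <= 1 -> (forall k, `|phi k| <= B) ->
  mean s (fun k => c * phi k) = c * mean s phi.
Proof.
move=> s01 hphi; apply: cvg_lim => //.
rewrite [X in X @ \oo --> _](_ : _ =
  (fun n => c * (\sum_(k < n) digit_pr s k * phi k))).
  by apply: cvgMl_tmp; exact: mean_cvg hphi.
apply/funext => n; rewrite mulr_sumr; apply: eq_bigr => k _.
by rewrite mulrCA.
Qed.

Lemma mean_le s phi psi B C : 0 <= s <= 1 ->
  (forall k, `|phi k| <= B) -> (forall k, `|psi k| <= C) ->
  (forall k, phi k <= psi k) -> mean s phi <= mean s psi.
Proof.
move=> s01 hphi hpsi le_phi_psi.
apply: ler_cvg_to (mean_cvg s01 hphi) (mean_cvg s01 hpsi) _.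
apply: nearW => n; apply: ler_sum => k _.
by rewrite ler_wpM2l ?digit_pr_ge0.
Qed.

Lemma mean_shift_le s phi c B : 0 <= s <= 1 ->
  (forall k, `|phi k - c| <= B) -> `|mean s phi - c| <= B.
Proof.
move=> s01 h.
have hphi k : `|phi k| <= B + `|c|.
  by rewrite -[phi k](subrK c) (le_trans (ler_normD _ _))// lerD2r.
have hc C (k : nat) : `|(fun=> C : R) k| <= `|C| by [].
rewrite ler_norml lerBrDr lerBlDr.
apply/andP; split.
  rewrite -[leLHS](mean_cst _ s01); apply: (mean_le s01 (hc _) hphi) => k.
  by have := h k; rewrite ler_norml; lra.
rewrite -[leRHS](mean_cst _ s01); apply: (mean_le s01 hphi (hc _)) => k.
by have := h k; rewrite ler_norml; lra.
Qed.

Lemma partial_le_mean s phi B n : 0 <= s <= 1 ->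
  (forall k, 0 <= phi k <= B) ->
  \sum_(k < n) digit_pr s k * phi k <= mean s phi.
Proof.
move=> s01 h.
have h' k : `|phi k| <= B by case/andP: (h k) => p0 pB; rewrite ger0_norm.
apply: (nondecreasing_cvgn_le _ (mean_cvg s01 h')).
apply/nondecreasing_seqP => m; rewrite big_ord_recr /= lerDl.
by rewrite mulr_ge0 ?digit_pr_ge0//; case/andP: (h m).
Qed.

Lemma mean_finite s phi M : 0 <= s <= 1 ->
  (forall k, (M <= k)%N -> phi k = 0) ->
  mean s phi = \sum_(k < M) digit_pr s k * phi k.
Proof.
move=> s01 h; apply: cvg_lim => //.
apply: cvg_near_cst; exists M => // n /= Mn.
rewrite -(subnKC Mn) big_split_ord /= [X in _ + X]big1 ?addr0// => k _.
by rewrite h ?mulr0// leq_addr.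
Qed.

End MeanTheory.

(** * The digit operator contracts Lipschitz functions *)

(** Replaces differences of probabilities by differences of tails, which are small
    and all of the same sign; this is the coupling of two next digits that keeps
    their order. *)
Lemma summation_by_parts (R : realType) (D g : nat -> R) n :
  \sum_(k < n) (D k - D k.+1) * g k =
  D 0%N * g 0%N + \sum_(k < n) D k.+1 * (g k.+1 - g k) - D n * g n.
Proof.
elim: n => [|n IH]; first by rewrite !big_ord0; ring.
by rewrite !big_ord_recr /= IH; ring.
Qed.

Section Contraction.
Context (R : realType).
Implicit Types (s t : R).

Lemma digit_tailB s t k : 0 <= s <= 1 -> 0 <= t <= 1 ->
  digit_tail s k - digit_tail t k =
  (s - t) * (k%:R / ((k.+1%:R + s) * (k.+1%:R + t))).
Proof.
move=> /andP[s0 s1] /andP[t0 t1]; rewrite /digit_tail -natr1.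
have := ler0n R k.
by move=> k0; field; apply/andP; split; apply: lt0r_neq0; lra.
Qed.

Lemma digit_tailB_le s t k : 0 <= s <= 1 -> 0 <= t <= 1 ->
  `|digit_tail s k - digit_tail t k| <= `|s - t| * (k%:R / k.+1%:R ^+ 2).
Proof.
move=> s01 t01; rewrite digit_tailB// normrM ler_wpM2l//.
move: s01 t01 => /andP[s0 s1] /andP[t0 t1].
have k0 := ler0n R k; have k1 : 0 < k.+1%:R :> R by rewrite ltr0n.
rewrite ger0_norm ?divr_ge0 ?mulr_ge0 ?addr_ge0 ?(ltW k1)//.
rewrite ler_wpM2l// lef_pV2 ?posrE ?exprn_gt0 ?mulr_gt0 ?ltr_wpDr//.
by rewrite expr2 ler_pM ?lerDl// ltW.
Qed.

Lemma nextB s t k : 0 <= s <= 1 -> 0 <= t <= 1 ->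
  next_state s k - next_state t k = (t - s) / ((k.+1%:R + s) * (k.+1%:R + t)).
Proof.
move=> /andP[s0 s1] /andP[t0 t1]; rewrite /next_state.
have : 0 < k.+1%:R :> R by rewrite ltr0n.
by move=> k0; field; apply/andP; split; apply: lt0r_neq0; lra.
Qed.

Lemma nextS_le t k : 0 <= t <= 1 ->
  `|next_state t k.+1 - next_state t k| <= 1 / (k.+1%:R * k.+2%:R).
Proof.
move=> /andP[t0 t1]; rewrite /next_state -[k.+2%:R]natr1.
have : 0 < k.+1%:R :> R by rewrite ltr0n.
set K := _%:R => k0.
have -> : (K + 1 + t)^-1 - (K + t)^-1 = - (1 / ((K + t) * (K + 1 + t))).
  by field; apply/andP; split; apply: lt0r_neq0; lra.
rewrite normrN ger0_norm ?divr_ge0 ?mulr_ge0 ?addr_ge0 ?(ltW k0)//.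
rewrite ler_wpM2l// lef_pV2 ?posrE ?mulr_gt0 ?ltr_wpDr ?addr_gt0//.
by apply: ler_pM; lra.
Qed.

(** First half of the contraction estimate, where the digit is the same and only
    the state differs. The worst digit is 1, with weight at most 1/2; the other
    digits contribute at most 1/6. *)
Lemma transport_sum_le s t n : 0 <= s <= 1 -> 0 <= t <= 1 ->
  \sum_(k < n) digit_pr s k * `|next_state s k - next_state t k|
    <= 2 / 3 * `|s - t|.
Proof.
move=> s01 t01.
have tk k : digit_pr s k * `|next_state s k - next_state t k| <=
    (if k == 0%N then 1 / 2 else 1 / (3 * (k.+1%:R * k.+2%:R))) * `|s - t|.
  rewrite nextB// normrM (distrC t s) [leLHS]mulrCA [leLHS]mulrC ler_wpM2r//.
  move: s01 t01 => /andP[s0 s1] /andP[t0 t1].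
  have k1 : 1 <= k.+1%:R :> R by rewrite ler1n.
  rewrite ger0_norm ?invr_ge0 ?mulr_ge0 ?addr_ge0 ?ler0n//.
  rewrite /digit_pr -[k.+2%:R]natr1.
  set K := k.+1%:R in k1 *.
  have -> : (1 + s) / ((K + s) * (K + 1 + s)) / ((K + s) * (K + t)) =
      (1 + s) / (K + s) * ((K + 1 + s) * (K + s) * (K + t))^-1.
    by field; do ?(apply/andP; split); apply: lt0r_neq0; lra.
  have a1 : K * (K + 1) <= (K + s) * (K + 1 + s).
    by rewrite ler_pM; lra.
  have a2 : K * (K + 1) * K <= (K + 1 + s) * (K + s) * (K + t).
    by rewrite ler_pM ?mulr_ge0//; lra.
  have K0 : 0 < K * (K + 1) * K by rewrite !mulr_gt0//; lra.
  case: eqP => [k0|/eqP k0].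
    have KE : K = 1 by rewrite /K k0.
    rewrite KE divff ?mul1r; last by apply: lt0r_neq0; lra.
    rewrite lef_pV2 ?posrE; last 2 first.
    - by rewrite !mulr_gt0//; lra.
    - lra.
    by move: a2; rewrite KE; lra.
  have K2 : 2 <= K by rewrite /K -(natr1 k) (_ : 2 = 1 + 1)// lerD2r ler1n lt0n.
  apply: (@le_trans _ _ (2 / (K + 1) * (K * (K + 1) * K)^-1)).
    apply: ler_pM; rewrite ?invr_ge0 ?divr_ge0 ?mulr_ge0//; try lra.
      rewrite ler_pdivrMr; last lra.
      by rewrite mulrAC ler_pdivlMr; [nra|lra].
    by rewrite lef_pV2 ?posrE// (lt_le_trans K0).
  rewrite -subr_ge0.
  have -> : 1 / (3 * (K * (K + 1))) - 2 / (K + 1) * (K * (K + 1) * K)^-1 =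
     (K * (K + 1) - 6) / (3 * (K * (K + 1) * K) * (K + 1)).
    by field; do ?(apply/andP; split); apply: lt0r_neq0; lra.
  apply: divr_ge0; first nra.
  by rewrite !mulr_ge0//; lra.
apply: (@le_trans _ _ (\sum_(k < n)
  (if k == 0%N :> nat then 1 / 2 else 1 / (3 * (k.+1%:R * k.+2%:R))) * `|s - t|)).
  by apply: ler_sum => k _; exact: tk.
rewrite -mulr_suml ler_wpM2r//.
have bound m : \sum_(k < m.+1)
    (if k == 0%N :> nat then 1 / 2 else 1 / (3 * (k.+1%:R * k.+2%:R))) =
    2 / 3 - 1 / (3 * m.+2%:R) :> R.
  elim: m => [|m IH]; first by rewrite big_ord_recl big_ord0 /=; lra.
  rewrite big_ord_recr IH /= -[m.+3%:R]natr1.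
  have : 0 < m.+2%:R :> R by rewrite ltr0n.
  by move=> m0; field; apply/andP; split; apply: lt0r_neq0; lra.
case: n => [|n]; first by rewrite big_ord0; lra.
by rewrite bound gerBl divr_ge0// mulr_ge0// ler0n.
Qed.

(** Second half of the contraction estimate, where the law of the digit changes:
    the change of the tail times the distance of neighbouring states. *)
Lemma rearrangement_sum_le n :
  \sum_(k < n) (k.+1%:R / k.+2%:R ^+ 2 * (1 / (k.+1%:R * k.+2%:R)))
    <= 1 / 4 :> R.
Proof.
have bound m : \sum_(k < m) (1 / (k.+1%:R * k.+2%:R * k.+3%:R)) =
    1 / 4 - 1 / (2 * m.+1%:R * m.+2%:R) :> R.
  elim: m => [|m IH]; first by rewrite big_ord0; lra.
  rewrite big_ord_recr IH /= -[m.+3%:R]natr1 -[m.+2%:R]natr1.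
  have : 0 < m.+1%:R :> R by rewrite ltr0n.
  by move=> m0; field; do ?(apply/andP; split); apply: lt0r_neq0; lra.
apply: (@le_trans _ _ (\sum_(k < n) (1 / (k.+1%:R * k.+2%:R * k.+3%:R)))).
  apply: ler_sum => k _.
  rewrite -[k.+3%:R]natr1 -[k.+2%:R]natr1.
  have : 0 < k.+1%:R :> R by rewrite ltr0n.
  set K := _%:R => K0.
  have -> : K / (K + 1) ^+ 2 * (1 / (K * (K + 1))) = 1 / (K + 1) ^+ 3.
    by field; do ?(apply/andP; split); apply: lt0r_neq0; lra.
  rewrite ler_wpM2l// lef_pV2 ?posrE ?exprn_gt0 ?mulr_gt0//; lra.
by rewrite bound gerBl divr_ge0// !mulr_ge0 ?ler0n.
Qed.

Definition lipschitz01 (L : R) (f : R -> R) :=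
  forall s t, 0 <= s <= 1 -> 0 <= t <= 1 -> `|f s - f t| <= L * `|s - t|.

(** The operator of the Markov chain of states s. *)
Definition transfer (f : R -> R) (s : R) : R :=
  mean s (fun k => f (next_state s k)).

Lemma lipschitz01_ge0 L f : lipschitz01 L f -> 0 <= L.
Proof.
move=> /(_ 1 0); rewrite !lexx ler01 => /(_ isT isT).
by rewrite subr0 normr1 mulr1; exact: le_trans.
Qed.

Lemma lipschitz01_bound L f s : lipschitz01 L f -> 0 <= s <= 1 ->
  `|f s| <= `|f 0| + L.
Proof.
move=> Lf s01; rewrite -[f s](subrK (f 0)) (le_trans (ler_normD _ _))//.
rewrite addrC lerD2l; apply: (le_trans (Lf _ _ s01 _)); first by rewrite lexx ler01.
move/andP: s01 => [s0 s1].
by rewrite subr0 ger0_norm// ler_piMr// (lipschitz01_ge0 Lf).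
Qed.

(** 2/3 + 1/4 = 11/12: the new states move closer together, and the change in the
    law of the digit is paid by neighbouring values of f on the states. *)
Lemma transfer_lipschitz L f : lipschitz01 L f ->
  lipschitz01 (11 / 12 * L) (transfer f).
Proof.
move=> Lf s t s01 t01.
have L0 := lipschitz01_ge0 Lf.
pose B := `|f 0| + L.
have Bs u : 0 <= u <= 1 -> forall k, `|f (next_state u k)| <= B.
  by move=> u01 k; exact: lipschitz01_bound Lf (next_itv _ _).
pose S u n := \sum_(k < n) digit_pr u k * f (next_state u k).
have main n : `|S s n - S t n| <=
    11 / 12 * L * `|s - t| + `|s - t| * B * harmonic n.
  (* Change the state with the law of the digit fixed, then change the law. *)
  have -> : S s n - S t n =
      \sum_(k < n) digit_pr s k * (f (next_state s k) - f (next_state t k))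
    + \sum_(k < n) (digit_pr s k - digit_pr t k) * f (next_state t k).
    rewrite -big_split -sumrB; apply: eq_bigr => k _ /=; ring.
  apply: (le_trans (ler_normD _ _)).
  have h1 : `|\sum_(k < n) digit_pr s k * (f (next_state s k) - f (next_state t k))| <=
      2 / 3 * L * `|s - t|.
    apply: (le_trans (ler_norm_sum _ _ _)).
    apply: (@le_trans _ _
      (L * \sum_(k < n) digit_pr s k * `|next_state s k - next_state t k|)).
      rewrite mulr_sumr; apply: ler_sum => k _.
      rewrite normrM (ger0_norm (digit_pr_ge0 k s01)) mulrCA.
      by rewrite ler_wpM2l ?digit_pr_ge0// Lf// next_itv.
    have := ler_wpM2l L0 (transport_sum_le n s01 t01); lra.
  have h2 : `|\sum_(k < n) (digit_pr s k - digit_pr t k) * f (next_state t k)| <=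
      1 / 4 * L * `|s - t| + `|s - t| * B * harmonic n.
    pose D k := digit_tail s k - digit_tail t k.
    have -> : \sum_(k < n) (digit_pr s k - digit_pr t k) * f (next_state t k) =
        \sum_(k < n) (D k - D k.+1) * f (next_state t k).
      by apply: eq_bigr => k _; rewrite /D !digit_prE//; congr (_ * _); ring.
    rewrite (summation_by_parts D (fun k => f (next_state t k))).
    have -> : D 0%N = 0 by rewrite /D digit_tailB// mul0r mulr0.
    rewrite mul0r add0r.
    apply: (le_trans (ler_normB _ _)); apply: lerD.
      apply: (le_trans (ler_norm_sum _ _ _)).
      apply: (@le_trans _ _ ((L * `|s - t|) * \sum_(k < n)
          (k.+1%:R / k.+2%:R ^+ 2 * (1 / (k.+1%:R * k.+2%:R))))).
        rewrite mulr_sumr; apply: ler_sum => k _.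
        rewrite normrM [leRHS](_ : _ = (`|s - t| * (k.+1%:R / k.+2%:R ^+ 2)) *
          (L * (1 / (k.+1%:R * k.+2%:R)))); last by ring.
        apply: ler_pM => //; first exact: digit_tailB_le.
        apply: (le_trans (Lf _ _ (next_itv _ t01) (next_itv _ t01))).
        by rewrite ler_wpM2l// nextS_le.
      have := ler_wpM2l (mulr_ge0 L0 (normr_ge0 (s - t)))
        (rearrangement_sum_le n); lra.
    rewrite normrM mulrAC; apply: ler_pM => //; last exact: Bs.
    apply: (le_trans (digit_tailB_le n s01 t01)).
    rewrite ler_wpM2l// /harmonic /= expr2 invfM mulrA ler_piMl ?invr_ge0//.
    by rewrite ler_pdivrMr ?ltr0n// mul1r ler_nat.
  lra.
have cS u (u01 : 0 <= u <= 1) := mean_cvg u01 (Bs u u01).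
have h1 : (fun n => `|S s n - S t n|) @ \oo --> `|transfer f s - transfer f t|.
  by apply: cvg_norm; apply: cvgB; exact: cS.
apply: ler_cvg_to h1 _ (nearW _ main).
rewrite -[X in _ --> X]addr0; apply: cvgD; first exact: cvg_cst.
rewrite -[X in _ --> X](mulr0 (`|s - t| * B)).
by apply: cvgMl_tmp; exact: cvg_harmonic.
Qed.

End Contraction.

(** * Truncated digits: second moments and a maximal inequality *)

Definition cap (M a : nat) : nat := if (a <= M)%N then a else 0%N.

Definition harm (R : realType) (M : nat) : R := \sum_(k < M) k.+1%:R^-1.

(** A Lipschitz constant for the mean of the next truncated digit. *)
Definition lip_cap (R : realType) (M : nat) : R := harm R M + 1.

Definition cap_mean (R : realType) (M : nat) (s : R) : R :=
  mean s (fun k => (cap M k.+1)%:R).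

(** The expectation, in state s, of the truncated digit that comes i digits after
    the next one. *)
Definition future_mean (R : realType) (M i : nat) : R -> R :=
  iter i (@transfer R) (cap_mean M).

(** The common limit of the functions future_mean M i. All the lower bounds of the
    set lie below all the upper bounds future_mean + (11/12)^i L, so the supremum
    lies between them; the element harm / 3 makes it bounded below by the
    harmonic sum. *)
Definition limit_mean (R : realType) (M : nat) : R :=
  sup [set x : R | x = harm R M / 3 \/
    exists i s, 0 <= s <= 1 /\
      x = future_mean M i s - (11 / 12) ^+ i * lip_cap R M].

Section CappedDigit.
Context (R : realType) (M : nat).
Implicit Types (s t c : R) (a : nat -> nat).

Local Notation L := (lip_cap R M).
Local Notation theta := (11 / 12 : R).
Local Notation pi := (limit_mean R M).

Lemma harm_ge0 : 0 <= harm R M.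
Proof. by apply: sumr_ge0 => k _; rewrite invr_ge0 ler0n. Qed.

Lemma cap_le (v : nat) : ((cap M v)%:R : R) <= M%:R.
Proof. by rewrite ler_nat /cap; case: ifP. Qed.

Lemma cap_norm (v : nat) : `|(cap M v)%:R : R| <= M%:R.
Proof. by rewrite ger0_norm ?ler0n// cap_le. Qed.

Lemma cap_meanE s : 0 <= s <= 1 ->
  cap_mean M s = \sum_(k < M) digit_pr s k * k.+1%:R.
Proof.
move=> s01; rewrite /cap_mean (@mean_finite _ _ _ M)//.
  by apply: eq_bigr => k _; rewrite /cap ltn_ord.
by move=> k Mk; rewrite /cap ltnNge Mk.
Qed.

Lemma cap_mean_lipschitz : lipschitz01 L (cap_mean M).
Proof.
move=> s t s01 t01; rewrite !cap_meanE// -sumrB.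
pose D k := digit_tail s k - digit_tail t k.
have -> : \sum_(k < M) (digit_pr s k * k.+1%:R - digit_pr t k * k.+1%:R) =
    \sum_(k < M) (D k - D k.+1) * k.+1%:R.
  by apply: eq_bigr => k _; rewrite /D (digit_prE _ s01) (digit_prE _ t01); ring.
rewrite (summation_by_parts D (fun k => k.+1%:R)).
have -> : D 0%N = 0 by rewrite /D digit_tailB// mul0r mulr0.
rewrite mul0r add0r /lip_cap [leRHS]mulrDl mul1r /harm mulr_suml.
have Dk k : `|D k| <= `|s - t| * (k%:R / k.+1%:R ^+ 2) by exact: digit_tailB_le.
apply: (le_trans (ler_normB _ _)); apply: lerD.
  apply: (le_trans (ler_norm_sum _ _ _)); apply: ler_sum => k _.
  rewrite -(natr1 k.+1) [k.+1%:R + 1]addrC addrK mulr1.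
  apply: (le_trans (Dk _)); rewrite mulrC ler_wpM2r//.
  rewrite -[k.+2%:R]natr1.
  have : 0 < k.+1%:R :> R by rewrite ltr0n.
  set K := _%:R => K0.
  rewrite ler_pdivrMr ?exprn_gt0//; last lra.
  by rewrite ler_pdivlMl//; nra.
rewrite normrM (ger0_norm (ler0n _ _)).
apply: (le_trans (ler_wpM2r (ler0n _ _) (Dk M))).
rewrite -mulrA ler_piMr//.
have : 0 < M.+1%:R :> R by rewrite ltr0n.
rewrite -natr1; have := ler0n R M.
set K := M%:R => K0 K1.
by rewrite mulrAC ler_pdivrMr ?exprn_gt0//; nra.
Qed.

Lemma cap_mean_ge s : 0 <= s <= 1 -> harm R M / 3 <= cap_mean M s.
Proof.
move=> s01; rewrite cap_meanE// /harm mulr_suml; apply: ler_sum => k _.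
move/andP: s01 => [s0 s1]; rewrite /digit_pr -[k.+2%:R]natr1.
have : 1 <= k.+1%:R :> R by rewrite ler1n.
set K := _%:R => K0.
rewrite -subr_ge0.
have -> : (1 + s) / ((K + s) * (K + 1 + s)) * K - K^-1 / 3 =
  ((1 + s) * K * K * 3 - (K + s) * (K + 1 + s)) / (3 * K * ((K + s) * (K + 1 + s))).
  by field; do ?(apply/andP; split); apply: lt0r_neq0; lra.
apply: divr_ge0; last by rewrite !mulr_ge0//; lra.
have h1 : K + s <= (1 + s) * K by nra.
have h2 : K + 1 + s <= 3 * K by lra.
rewrite subr_ge0 [leRHS](_ : _ = ((1 + s) * K) * (3 * K)); last by ring.
by apply: ler_pM => //; lra.
Qed.

Lemma cap_square_mean s : 0 <= s <= 1 ->
  mean s (fun k => (cap M k.+1)%:R ^+ 2) <= 2 * M%:R.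
Proof.
move=> s01; rewrite (@mean_finite _ _ _ M)//; last first.
  by move=> k Mk; rewrite /cap ltnNge Mk expr0n.
rewrite [leRHS](_ : _ = \sum_(k < M) 2); last first.
  by rewrite sumr_const card_ord mulr_natr.
apply: ler_sum => k _; rewrite /cap ltn_ord.
move/andP: s01 => [s0 s1]; rewrite /digit_pr -[k.+2%:R]natr1.
have : 1 <= k.+1%:R :> R by rewrite ler1n.
set K := _%:R => K0.
have d0 : 0 < (K + s) * (K + 1 + s) by rewrite mulr_gt0//; lra.
by rewrite mulrAC ler_pdivrMr//; nra.
Qed.

Lemma future_mean_lipschitz i :
  lipschitz01 (theta ^+ i * L) (future_mean M i).
Proof.
elim: i => [|i IH]; first by rewrite expr0 mul1r; exact: cap_mean_lipschitz.
by rewrite exprS -mulrA; exact: transfer_lipschitz.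
Qed.

Lemma lip_cap_gt0 : 0 < L.
Proof. by rewrite /lip_cap ltr_wpDl// harm_ge0. Qed.

Lemma theta_L_ge0 i : 0 <= theta ^+ i * L.
Proof. by rewrite mulr_ge0 ?exprn_ge0 ?ltW ?lip_cap_gt0//; lra. Qed.

Lemma future_mean_bounded i :
  exists B, forall s, 0 <= s <= 1 -> `|future_mean M i s| <= B.
Proof.
eexists => s s01.
exact: (lipschitz01_bound (@future_mean_lipschitz i) s01).
Qed.

(** Means at later times are averages of means at time i, hence lie within the
    oscillation of the latter. *)
Lemma future_mean_close i j s t : (i <= j)%N -> 0 <= s <= 1 -> 0 <= t <= 1 ->
  `|future_mean M j t - future_mean M i s| <= theta ^+ i * L.
Proof.
move=> ij s01; rewrite -(subnK ij).
elim: (j - i)%N t => [|n IH] t t01.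
  rewrite add0n; apply: (le_trans (future_mean_lipschitz i t01 s01)).
  rewrite ler_piMr ?theta_L_ge0//.
  by rewrite ler_norml; move: s01 t01 => /andP[? ?] /andP[? ?]; lra.
rewrite addSn; apply: mean_shift_le => // k.
by apply: IH; exact: next_itv.
Qed.

Lemma future_mean_ge i s : 0 <= s <= 1 -> harm R M / 3 <= future_mean M i s.
Proof.
elim: i s => [|i IH] s s01; first exact: cap_mean_ge.
rewrite -(mean_cst (harm R M / 3) s01).
have [B hB] := future_mean_bounded i.
apply: (mean_le s01 (B := `|harm R M / 3|) (C := B)) => // k.
  by apply: hB; exact: next_itv.
by apply: IH; exact: next_itv.
Qed.

Lemma limit_mean_spec :
  harm R M / 3 <= pi /\
  forall i s, 0 <= s <= 1 -> `|future_mean M i s - pi| <= theta ^+ i * L.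
Proof.
rewrite /limit_mean; set S := [set x | _].
have ub i s : 0 <= s <= 1 -> ubound S (future_mean M i s + theta ^+ i * L).
  move=> s01 _ [->|[j [t [t01 ->]]]].
    by rewrite ler_wpDr ?theta_L_ge0// future_mean_ge.
  rewrite lerBlDr; case: (leqP i j) => ij.
    have := future_mean_close ij s01 t01; have := theta_L_ge0 j.
    rewrite ler_norml; lra.
  have := future_mean_close (ltnW ij) t01 s01; have := theta_L_ge0 i.
  rewrite ler_norml; lra.
have z01 : 0 <= (0 : R) <= 1 by lra.
have hub : has_ubound S by eexists; exact: ub 0%N 0 z01.
split; first by apply: ub_le_sup => //; left.
move=> i s s01; rewrite ler_norml; apply/andP; split.
  rewrite lerBrDr addrC -lerBrDr opprK; apply: ge_sup; last exact: ub.
  by exists (harm R M / 3); left.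
rewrite lerBlDr addrC -lerBlDr; apply: ub_le_sup => //; right.
by exists i, s.
Qed.

(** Expected value, in state s, of the sum over the next r digits with weights
    alternately 1 and 0, beginning with b, of the truncated digit minus its limit
    mean. Taking b true or false selects the even or the odd positions. *)
Definition drift (r : nat) (b : bool) (s : R) : R :=
  \sum_(i < r) (b (+) odd i)%:R * (future_mean M i s - pi).

Lemma drift_norm r b s : 0 <= s <= 1 -> `|drift r b s| <= 12 * L.
Proof.
move=> s01; apply: (le_trans (ler_norm_sum _ _ _)).
apply: (@le_trans _ _ (\sum_(i < r) theta ^+ i * L)).
  apply: ler_sum => i _; rewrite normrM.
  have [_ /(_ i s s01) h] := limit_mean_spec.
  by case: (_ (+) _); rewrite ?normr1 ?mul1r// normr0 mul0r theta_L_ge0.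
rewrite -mulr_suml ler_wpM2r ?(ltW lip_cap_gt0)//.
rewrite [leLHS](_ : _ = 12 * (1 - theta ^+ r)).
  by rewrite ler_piMr// gerBl exprn_ge0//; lra.
elim: r => [|r IH]; first by rewrite big_ord0 expr0; ring.
by rewrite big_ord_recr IH /= exprS; field.
Qed.

Lemma driftS r b s : 0 <= s <= 1 ->
  drift r.+1 b s =
  b%:R * (cap_mean M s - pi) + transfer (drift r (~~ b)) s.
Proof.
move=> s01; rewrite /drift big_ord_recl /= addbF; congr (_ + _).
have n01 k := next_itv k s01.
elim: r => [|r IH].
  rewrite big_ord0 /transfer -[LHS](mean_cst 0 s01).
  by congr mean; apply/funext => k; rewrite big_ord0.
rewrite big_ord_recr IH /= /transfer.
have [B hB] := future_mean_bounded r.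
have hB1 k : `|future_mean M r (next_state s k) - pi| <= theta ^+ r * L.
  by apply: limit_mean_spec.2.
have hB2 k : `|(~~ b (+) odd r)%:R * (future_mean M r (next_state s k) - pi)|
    <= theta ^+ r * L.
  rewrite normrM; case: (_ (+) _); rewrite ?normr1 ?mul1r// normr0 mul0r.
  exact: theta_L_ge0.
have -> : (fun k => \sum_(i < r.+1) (~~ b (+) odd i)%:R *
      (future_mean M i (next_state s k) - pi)) =
    (fun k => drift r (~~ b) (next_state s k) +
      (~~ b (+) odd r)%:R * (future_mean M r (next_state s k) - pi)).
  by apply/funext => k; rewrite big_ord_recr.
rewrite (meanD s01 (fun k => drift_norm r (~~ b) (n01 k)) hB2).
congr (_ + _); rewrite (meanZ _ s01 hB1).
rewrite (meanD s01 (fun k => hB _ (n01 k)) (C := `|pi|)).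
  by rewrite mean_cst// addbN addNb.
by move=> k; rewrite normrN.
Qed.

(** The step of the martingale that consists of the partial sum plus the drift of
    its remaining part, when the next digit is v. *)
Definition increment (r : nat) (b : bool) (s : R) (v : nat) : R :=
  b%:R * ((cap M v)%:R - pi) + drift r (~~ b) (v%:R + s)^-1
  - drift r.+1 b s.

(** Truncation makes the second moment of a digit linear in M; everything else in
    an increment is bounded by the limit mean and the Lipschitz constant. *)
Definition step_var : R := 4 * M%:R + 2 * (pi + 24 * L) ^+ 2.

(** The martingale property, i.e. the recursion driftS. *)
Lemma increment_mean r b s : 0 <= s <= 1 ->
  mean s (fun k => increment r b s k.+1) = 0.
Proof.
move=> s01; rewrite /increment.
have n01 k := next_itv k s01.
pose e : R := - (b%:R * pi) - drift r.+1 b s.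
have -> : (fun k => b%:R * ((cap M k.+1)%:R - pi)
      + drift r (~~ b) (k.+1%:R + s)^-1 - drift r.+1 b s) =
    (fun k => (b%:R * (cap M k.+1)%:R + drift r (~~ b) (next_state s k)) + e).
  by apply/funext => k; rewrite /e /next_state; ring.
have h1 k : `|b%:R * (cap M k.+1)%:R : R| <= M%:R.
  rewrite normrM; case: (b) => /=; rewrite ?normr1 ?mul1r ?cap_norm//.
  by rewrite normr0 mul0r.
have h2 k := drift_norm r (~~ b) (n01 k).
rewrite (meanD s01 (B := M%:R + 12 * L) (C := `|e|))//; last first.
  by move=> k; rewrite (le_trans (ler_normD _ _))// lerD.
rewrite (meanD s01 h1 h2) (meanZ _ s01 (fun k => cap_norm k.+1)) mean_cst//.
rewrite /e driftS// /transfer /cap_mean; ring.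
Qed.

Lemma limit_mean_ge0 : 0 <= pi.
Proof. by apply: le_trans limit_mean_spec.1; rewrite divr_ge0// harm_ge0. Qed.

Lemma increment_norm r b s k : 0 <= s <= 1 ->
  `|increment r b s k.+1| <= M%:R + (pi + 24 * L).
Proof.
move=> s01; rewrite /increment.
have d1 := drift_norm r (~~ b) (next_itv k s01).
have d2 := drift_norm r.+1 b s01.
have d3 := cap_norm k.+1; have p0 := limit_mean_ge0.
move: d1 d2 d3; rewrite /next_state !ler_norml; case: (b) => /=; lra.
Qed.

Lemma increment_square r b s k : 0 <= s <= 1 ->
  increment r b s k.+1 ^+ 2 <=
  2 * (cap M k.+1)%:R ^+ 2 + 2 * (pi + 24 * L) ^+ 2.
Proof.
move=> s01; rewrite /increment.
have d1 := drift_norm r (~~ b) (next_itv k s01).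
have d2 := drift_norm r.+1 b s01.
have p0 := limit_mean_ge0; have L0 := lip_cap_gt0.
pose y : R := - (b%:R * pi) + drift r (~~ b) (next_state s k) - drift r.+1 b s.
have y2 : y ^+ 2 <= (pi + 24 * L) ^+ 2.
  rewrite -[y ^+ 2]real_normK ?num_real// ler_pXn2r ?nnegrE//; last lra.
  by rewrite /y; move: d1 d2; rewrite !ler_norml; case: (b) => /=; lra.
pose x : R := b%:R * (cap M k.+1)%:R.
have x2 : x ^+ 2 <= (cap M k.+1)%:R ^+ 2.
  by rewrite /x; case: (b) => /=; rewrite ?mul1r// mul0r expr0n /= sqr_ge0.
rewrite [X in X ^+ 2](_ : _ = x + y); last by rewrite /x /y /next_state; ring.
have := sqr_ge0 (x - y); nra.
Qed.

Lemma increment_var r b s : 0 <= s <= 1 ->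
  mean s (fun k => increment r b s k.+1 ^+ 2) <= step_var.
Proof.
move=> s01.
have c2 k : `|((cap M k.+1)%:R : R) ^+ 2| <= M%:R ^+ 2.
  by rewrite normrX ler_pXn2r ?nnegrE ?cap_norm.
have c3 k : `|2 * ((cap M k.+1)%:R : R) ^+ 2| <= 2 * M%:R ^+ 2.
  by rewrite normrM ger0_norm// ler_wpM2l.
pose e : R := 2 * (pi + 24 * L) ^+ 2.
apply: (@le_trans _ _ (mean s (fun k => 2 * (cap M k.+1)%:R ^+ 2 + e))).
  apply: (mean_le s01 (B := (M%:R + (pi + 24 * L)) ^+ 2)
    (C := 2 * M%:R ^+ 2 + `|e|)) => k; last exact: increment_square.
    rewrite normrX ler_pXn2r ?nnegrE ?increment_norm//.
    by rewrite (le_trans (normr_ge0 _) (increment_norm r b k s01)).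
  by rewrite (le_trans (ler_normD _ _))// lerD.
rewrite (meanD s01 c3 (C := `|e|))// mean_cst// (meanZ _ s01 c2).
have := cap_square_mean s01; rewrite /step_var /e; lra.
Qed.

Lemma step_var_ge0 : 0 <= step_var.
Proof.
by apply: addr_ge0; apply: mulr_ge0; rewrite ?ler0n ?sqr_ge0.
Qed.

Lemma second_moment_step r b s c n : 0 <= s <= 1 ->
  \sum_(k < n) digit_pr s k * (c + increment r b s k.+1) ^+ 2
    <= c ^+ 2 + step_var.
Proof.
move=> s01; have X1 k := increment_norm r b k s01.
have B0 := le_trans (normr_ge0 _) (X1 0%N).
set B := M%:R + _ in X1 B0.
have X2 k : `|increment r b s k.+1 ^+ 2| <= B ^+ 2.
  by rewrite normrX ler_pXn2r ?nnegrE.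
have cX k : `|(2 * c) * increment r b s k.+1| <= `|2 * c| * B.
  by rewrite normrM ler_wpM2l.
apply: (@le_trans _ _ (mean s (fun k => (c + increment r b s k.+1) ^+ 2))).
  apply: (partial_le_mean (B := (`|c| + B) ^+ 2)) => // k; rewrite sqr_ge0 /=.
  rewrite -[leLHS]real_normK ?num_real// ler_pXn2r ?nnegrE ?(addr_ge0 (normr_ge0 c) B0)//.
  by rewrite (le_trans (ler_normD _ _))// lerD2l.
have -> : (fun k => (c + increment r b s k.+1) ^+ 2) =
    (fun k => c ^+ 2 + ((2 * c) * increment r b s k.+1
      + increment r b s k.+1 ^+ 2)).
  by apply/funext => k; ring.
rewrite (meanD s01 (B := `|c ^+ 2|) (C := `|2 * c| * B + B ^+ 2))//; last first.
  by move=> k; rewrite (le_trans (ler_normD _ _))// lerD.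
rewrite (meanD s01 cX X2) (meanZ _ s01 X1) increment_mean// mean_cst//.
by rewrite mulr0 add0r lerD2l increment_var.
Qed.

(** The martingale started at c, over the next r digits a, leaves ]-lam, lam[. The
    recursion on r follows the digits, so that a probability bound can be proved
    by induction with law_le_step. *)
Fixpoint exceeds (lam : R) (r : nat) (b : bool) (c s : R) (a : nat -> nat) :
    Prop :=
  lam <= `|c| \/
  (if r is r'.+1 then
     exceeds lam r' (~~ b) (c + increment r' b s (a 0%N))
       ((a 0%N)%:R + s)^-1 (fun i => a i.+1)
   else False).

(** Kolmogorov's maximal inequality. If the martingale is already outside, the
    bound is at least 1; otherwise average the bound for the next state, where
    c^2 grows by at most step_var in the mean. *)
Lemma exceeds_law_le lam r b c s : 0 < lam -> 0 <= s <= 1 ->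
  law_le s [set a | exceeds lam r b c s a]
    ((c ^+ 2 + r%:R * step_var) / lam ^+ 2).
Proof.
move=> lam0; elim: r b c s => [|r IH] b c s s01;
  (case: (leP lam `|c|) => [lamc|clam]; last first).
- apply: (@law_le_mono _ _ _ 0 _ s01).
    by rewrite divr_ge0 ?sqr_ge0// addr_ge0 ?sqr_ge0// mul0r.
  by apply: law_le_set0 => a /= []//; rewrite leNgt clam.
- apply: (@law_le_mono _ _ _ 1 _ s01); last exact: law_le_all.
  rewrite ler_pdivlMr ?exprn_gt0// mul1r mul0r addr0.
  by rewrite -[leRHS]real_normK ?num_real// ler_pXn2r ?nnegrE// ltW.
- apply: (@law_le_step _ _ _ (fun k =>
    ((c + increment r b s k.+1) ^+ 2 + r%:R * step_var) / lam ^+ 2)) => //.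
    move=> k; apply: law_le_sub (IH (~~ b) _ _ (next_itv k s01)).
    by move=> a /= [|//]; rewrite leNgt clam.
  move=> n; under eq_bigr => k _ do rewrite mulrA mulrDr.
  rewrite -mulr_suml ler_wpM2r ?invr_ge0 ?sqr_ge0//.
  rewrite big_split /= -(natr1 r) mulrDl mul1r.
  have rK0 : 0 <= r%:R * step_var by rewrite mulr_ge0 ?step_var_ge0.
  have := partial_mean_le n s01 rK0 (fun _ => lexx _).
  have := second_moment_step r b c n s01; lra.
- apply: (@law_le_mono _ _ _ 1 _ s01); last exact: law_le_all.
  rewrite ler_pdivlMr ?exprn_gt0// mul1r.
  apply: ler_wpDr; first by rewrite mulr_ge0 ?step_var_ge0.
  by rewrite -[leRHS]real_normK ?num_real// ler_pXn2r ?nnegrE// ltW.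
Qed.

(** While the martingale stays inside, the partial sums differ from it by a drift,
    bounded independently of the number of digits. *)
Lemma exceedsN_bound lam r b c s a : 0 <= s <= 1 -> (forall i, 0 < a i)%N ->
  ~ exceeds lam r b c s a -> forall k, (k <= r)%N ->
  `|c + \sum_(i < k) (b (+) odd i)%:R * ((cap M (a i))%:R - pi) - drift r b s|
    < lam + 12 * L.
Proof.
elim: r b c s a => [|r IH] b c s a s01 a0 /= nex k kr.
  move: kr; rewrite leqn0 => /eqP ->; rewrite big_ord0 addr0.
  apply: (le_lt_trans (ler_normB _ _)); apply: ltr_leD; last exact: drift_norm.
  by rewrite ltNge; apply/negP => h; apply: nex; left.
case: k kr => [_|k kr].
  rewrite big_ord0 addr0.
  apply: (le_lt_trans (ler_normB _ _)); apply: ltr_leD; last exact: drift_norm.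
  by rewrite ltNge; apply/negP => h; apply: nex; left.
have s' : 0 <= ((a 0%N)%:R + s)^-1 <= 1.
  by have := next_itv (a 0%N).-1 s01; rewrite /next_state prednK.
have nex' : ~ exceeds lam r (~~ b) (c + increment r b s (a 0%N))
    ((a 0%N)%:R + s)^-1 (fun i => a i.+1) by move=> h; apply: nex; right.
have := IH _ _ _ _ s' (fun i => a0 i.+1) nex' k kr.
rewrite big_ord_recl /= addbF /increment.
under [X in _ -> `|_ + (_ + X) - _| < _]eq_bigr => i _ do rewrite addbN -addNb.
rewrite !addrA; congr (`|_| < _); ring.
Qed.

End CappedDigit.

(** Whatever the past, the next digit exceeds M with probability at most 2/M. So n
    digits contain on average at most n (2/M) large ones, and each further large
    digit that is required costs this factor once more. *)
Lemma digit_count_le (R : realType) (M n c : nat) (s : R) :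
  (0 < M)%N -> 0 <= s <= 1 ->
  law_le s [set a : nat -> nat | (c <= \sum_(i < n) (M < a i))%N]
    ((n%:R * (2 / M%:R)) ^+ c).
Proof.
move=> M0; elim: n c s => [|n IH] c s s01.
  case: c => [|c]; first by rewrite expr0; exact: law_le_all.
  by rewrite mul0r exprS mul0r; apply: law_le_set0 => a /=; rewrite big_ord0.
case: c => [|c]; first by rewrite expr0; exact: law_le_all.
set q : R := 2 / M%:R.
have q0 : 0 <= q by rewrite divr_ge0.
have nq0 : 0 <= n%:R * q by rewrite mulr_ge0.
apply: (@law_le_step _ _ _ (fun k =>
   (if (M < k.+1)%N then (n%:R * q) ^+ c else 0) + (n%:R * q) ^+ c.+1)) => //.
  move=> k; have := next_itv k s01.
  case: ifP => Mk s'.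
    apply: (@law_le_mono _ _ _ ((n%:R * q) ^+ c) _ s').
      by rewrite lerDl exprn_ge0.
    apply: law_le_sub (IH c _ s') => a /=.
    by rewrite big_ord_recl /= Mk add1n ltnS.
  rewrite add0r; apply: law_le_sub (IH c.+1 _ s') => a /=.
  by rewrite big_ord_recl /= Mk add0n.
move=> m; under eq_bigr => k _ do rewrite mulrDr.
rewrite big_split /=.
have h1 := partial_mean_le m s01 (exprn_ge0 c.+1 nq0) (fun _ => lexx _).
have h2 : \sum_(k < m) digit_pr s k *
    (if (M < k.+1)%N then (n%:R * q) ^+ c else 0) <= q * (n%:R * q) ^+ c.
  have tl : digit_tail s M <= q.
    have /andP[_ /le_trans] := digit_tail_itv M s01; apply.
    by rewrite ler_wpM2l// lef_pV2 ?posrE ?ltr0n// ler_nat.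
  apply: le_trans (ler_wpM2r (exprn_ge0 c nq0) tl).
  have pk k : 0 <= digit_pr s k * (if (M < k.+1)%N then (n%:R * q) ^+ c else 0).
    by rewrite mulr_ge0 ?digit_pr_ge0//; case: ifP; rewrite ?exprn_ge0.
  apply: (@le_trans _ _ (\sum_(k < M + m) digit_pr s k *
    (if (M < k.+1)%N then (n%:R * q) ^+ c else 0))).
    by rewrite addnC big_split_ord /= lerDl sumr_ge0.
  rewrite big_split_ord /= big1 ?add0r; last first.
    by move=> k _; rewrite ltnNge ltn_ord mulr0.
  under eq_bigr => k _ do rewrite ltnS leq_addr.
  rewrite -mulr_suml ler_wpM2r ?exprn_ge0//.
  have := digit_pr_sum (M + m) s01; rewrite big_split_ord /= digit_pr_sum//.
  by have /andP[] := digit_tail_itv (M + m) s01; lra.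
apply: (le_trans (lerD h2 h1)).
rewrite [_ ^+ c.+1 in leLHS]exprS -mulrDl exprS -(natr1 n).
have e0 : n%:R * q <= (n%:R + 1) * q by rewrite ler_wpM2r// lerDl.
apply: ler_pM; rewrite ?addr_ge0 ?exprn_ge0//; first lra.
by apply: lerXn2r; rewrite ?nnegrE// (le_trans nq0).
Qed.

(** * Dyadic scales and almost sure behaviour of the digits *)

(** The cube root of the scale, so that its square is the power 2/3. *)
Definition scale_root (R : realType) (j : nat) : R := j.+1%:R `^ 3^-1.

(** The exponent 2/3 balances the two error probabilities: with truncation at
    2^j g, two large digits cost 1/g^2 and the variance costs g/j^2, and both are
    summable for g = j^(2/3), while g/j tends to 0. *)
Definition threshold (R : realType) (j : nat) : nat :=
  Num.truncn (2 ^+ j * scale_root R j ^+ 2).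

Section Scales.
Context (R : realType).
Local Notation c := (scale_root R).
Local Notation M := (threshold R).
Local Notation pi j := (limit_mean R (threshold R j)).

Lemma scale_root_cube j : c j ^+ 3 = j.+1%:R.
Proof.
by rewrite /scale_root -powR_mulrn ?powR_ge0// -powRrM mulVf// powRr1// ler0n.
Qed.

Lemma scale_root_ge1 j : 1 <= c j.
Proof.
rewrite leNgt; apply/negP => c1.
have c0 : 0 <= c j by exact: powR_ge0.
have := scale_root_cube j; apply/eqP; rewrite lt_eqF//.
apply: (@lt_le_trans _ _ 1); last by rewrite ler1n.
by rewrite exprn_ilt1.
Qed.

Lemma scale_root_lt j : c j < c j.+1.
Proof.
have c0 k : 0 <= c k by exact: powR_ge0.
by rewrite -(@ltr_pXn2r _ 3) ?nnegrE// !scale_root_cube ltr_nat.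
Qed.

(** Convergence of the series of j^(-4/3), by comparison with a telescoping series:
    for consecutive cube roots a < b the identity b^3 - a^3 = 1 gives
    b - a >= 1/(3 b^2), hence 1/b^4 <= 3/a - 3/b. *)
Lemma scale_root_sum n : \sum_(j < n) (c j ^+ 4)^-1 <= 4.
Proof.
have bound m : \sum_(j < m.+1) (c j ^+ 4)^-1 <= 4 - 3 / c m.
  elim: m => [|m IH].
    by rewrite big_ord_recl big_ord0 /scale_root powR1 expr1n invr1; lra.
  rewrite big_ord_recr /=.
  suff : (c m.+1 ^+ 4)^-1 <= 3 / c m - 3 / c m.+1 by lra.
  have := scale_root_cube m.+1; rewrite -natr1 -scale_root_cube.
  have := scale_root_lt m; have := scale_root_ge1 m.
  set a := c m; set b := c m.+1 => a1 ab b3.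
  have ba : 1 <= 3 * b ^+ 2 * (b - a).
    have e1 : (b - a) * (a ^+ 2 + a * b + b ^+ 2) = 1.
      have -> : (b - a) * (a ^+ 2 + a * b + b ^+ 2) = b ^+ 3 - a ^+ 3 by ring.
      by rewrite b3; ring.
    by rewrite -[leLHS]e1 mulrC ler_wpM2r//; [lra|nra].
  have -> : 3 / a - 3 / b = 3 * (b - a) / (a * b).
    by field; apply/andP; split; apply: lt0r_neq0; lra.
  rewrite ler_pdivlMr ?mulr_gt0//; try lra.
  rewrite ler_pdivrMl ?exprn_gt0//; last lra.
  have -> : b ^+ 4 * (3 * (b - a)) = 3 * b ^+ 2 * (b - a) * (b * b) by ring.
  apply: (@le_trans _ _ (b * b)).
    by rewrite ler_wpM2r//; lra.
  by rewrite ler_peMl//; nra.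
case: n => [|n]; first by rewrite big_ord0.
apply: (le_trans (bound n)); rewrite gerBl divr_ge0//.
by rewrite (le_trans _ (scale_root_ge1 n)).
Qed.

Lemma half_power_sum n : \sum_(j < n) ((2 : R) ^+ j)^-1 <= 2.
Proof.
rewrite [leLHS](_ : _ = 2 - 2 / 2 ^+ n).
  by rewrite gerBl divr_ge0// exprn_ge0.
elim: n => [|n IH]; first by rewrite big_ord0 expr0; field.
rewrite big_ord_recr IH /= exprS; field.
by rewrite expf_neq0.
Qed.

Lemma threshold_itv j :
  2 ^+ j * c j ^+ 2 / 2 <= (M j)%:R <= 2 ^+ j * c j ^+ 2.
Proof.
have h1 : 1 <= 2 ^+ j * c j ^+ 2.
  by rewrite mulr_ege1// ?exprn_ege1 ?scale_root_ge1// ler1n.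
have := truncn_itv (le_trans ler01 h1); rewrite -/(M j) => /andP[-> h2].
rewrite andbT; have : 1 <= (M j)%:R :> R by rewrite ler1n /threshold truncn_gt0.
by move: h2; rewrite -(natr1 (M j)); lra.
Qed.

Lemma threshold_ge_pow j : (2 ^ j <= M j)%N.
Proof.
have c1 : 1 <= c j ^+ 2 by rewrite exprn_ege1// scale_root_ge1.
have P0 : 0 <= (2 : R) ^+ j by rewrite exprn_ge0.
rewrite /threshold truncn_ge_nat; first by rewrite natrX ler_peMr.
by rewrite mulr_ge0// (le_trans ler01).
Qed.

(** Each of the j doublings adds at least 1/2 to the harmonic sum. *)
Lemma harm_pow j : (j.+1)%:R / 2 <= harm R (2 ^ j).
Proof.
elim: j => [|j IH].
  by rewrite /harm expn0 big_ord_recl big_ord0 invr1; lra.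
rewrite expnS mul2n -addnn /harm big_split_ord /= -(natr1 j.+1) mulrDl.
apply: lerD; first exact: IH.
have n0 : 0 < (2 ^ j + 2 ^ j)%:R :> R by rewrite ltr0n addn_gt0 expn_gt0.
apply: (@le_trans _ _ (\sum_(i < 2 ^ j) ((2 ^ j + 2 ^ j)%:R)^-1)).
  rewrite sumr_const card_ord -[leRHS]mulr_natr [leRHS]mulrC ler_pdivlMr//.
  by rewrite natrD; lra.
apply: ler_sum => i _; rewrite lef_pV2 ?posrE ?n0 ?ltr0n//.
by rewrite ler_nat -addnS leq_add2l.
Qed.

Lemma limit_mean_ge j : c j ^+ 3 / 6 <= pi j.
Proof.
apply: le_trans (limit_mean_spec R (M j)).1.
rewrite scale_root_cube.
have : harm R (2 ^ j) <= harm R (M j).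
  rewrite /harm -(subnKC (threshold_ge_pow j)) big_split_ord /= lerDl.
  by apply: sumr_ge0 => i _; rewrite invr_ge0.
have := harm_pow j; lra.
Qed.

Lemma limit_mean_gt0 j : 0 < pi j.
Proof.
apply: lt_le_trans (limit_mean_ge j).
by rewrite divr_gt0// exprn_gt0// (lt_le_trans ltr01)// scale_root_ge1.
Qed.

Lemma lip_cap_le j : lip_cap R (M j) <= 9 * pi j.
Proof.
have h1 := (limit_mean_spec R (M j)).1.
have := limit_mean_ge j; have : 1 <= c j ^+ 3.
  by rewrite exprn_ege1// scale_root_ge1.
rewrite /lip_cap; lra.
Qed.

Lemma threshold_small (e : R) : 0 < e ->
  exists J, forall j, (J <= j)%N -> (M j)%:R <= e * (2 ^+ j * pi j).
Proof.
move=> e0; exists (Num.truncn ((6 / e) ^+ 3)) => j Jj.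
have /andP[_ h] := threshold_itv j; apply: (le_trans h).
rewrite [leRHS]mulrCA ler_wpM2l ?exprn_ge0//.
apply: le_trans (ler_wpM2l (ltW e0) (limit_mean_ge j)).
have ce : 6 / e <= c j.
  rewrite -(@ler_pXn2r _ 3) ?nnegrE ?divr_ge0 ?(ltW e0)//; last first.
    exact: powR_ge0.
  rewrite scale_root_cube ltW//; apply: (lt_le_trans (truncnS_gt _)).
  by rewrite ler_nat.
have c0 : 0 <= c j ^+ 2 by rewrite exprn_ge0// powR_ge0.
have -> : e * (c j ^+ 3 / 6) = c j ^+ 2 * (c j * e / 6) by ring.
by rewrite ler_peMr// ler_pdivlMr// mul1r -ler_pdivrMr.
Qed.

(** When the number of blocks is between 2^j and 2^(j+1), the digits that matter
    have an index below 2^(j+2), which is the range in both conditions. *)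
Definition typical_digits (a : nat -> nat) : Prop :=
  (forall e : R, 0 < e -> exists J, forall j b k, (J <= j)%N ->
     (k <= 2 ^ (j + 2))%N ->
     `|\sum_(i < k) (b (+) odd i)%:R * ((cap (M j) (a i))%:R - pi j)|
       <= e * (2 ^+ j * pi j)) /\
  exists J, forall j, (J <= j)%N ->
    (\sum_(i < 2 ^ (j + 2)) (M j < a i) <= 1)%N.

(** The first regular digit of 1 - x belongs to no block: it only determines the
    state in which the relevant digits start. *)
Lemma law_le_behead (S : nat -> set (nat -> nat)) (e : R) : 0 <= e ->
  (forall k, law_le (next_state 0 k) (S k.+1) e) ->
  law_le 0 [set a | S (a 0%N) (fun i => a i.+1)] e.
Proof.
move=> e0 Se; have z01 : 0 <= (0 : R) <= 1 by lra.
apply: (@law_le_step _ _ _ (fun=> e)) => // n.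
exact: partial_mean_le.
Qed.

Lemma next_state0 k : (k.+1%:R + 0)^-1 = next_state (0 : R) k.
Proof. by []. Qed.

Lemma deviation_negligible (e : R) (b : bool) : 0 < e ->
  (@lebesgue_measure R).-negligible
    [set x : R | forall J, exists2 j, (J <= j)%N & irr01 (1 - x) /\
       let a := gauss_seq (1 - x) in
       exceeds (M j) (e / 2 * (2 ^+ j * pi j)) (2 ^ (j + 2)) b 0
         ((a 0%N)%:R + 0)^-1 (fun i => a i.+1)].
Proof.
move=> e0; pose C1 : R := 16 / e ^+ 2 * 144.
pose C2 : R := 16 / e ^+ 2 * (2 * 217 ^+ 2).
have C10 : 0 <= C1.
  rewrite /C1; apply: mulr_ge0; last by rewrite ler0n.
  by rewrite divr_ge0 ?ler0n// exprn_ge0// ltW.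
have C20 : 0 <= C2.
  rewrite /C2; apply: mulr_ge0; first by rewrite divr_ge0 ?ler0n// exprn_ge0// ltW.
  by apply: mulr_ge0; rewrite ?ler0n ?sqr_ge0.
apply: (@limsup_negligible _ _
  (fun j => C1 * (c j ^+ 4)^-1 + C2 * (2 ^+ j)^-1) (C1 * 4 + C2 * 2)).
  move=> j; have p0 := limit_mean_gt0 j.
  have P0 : 0 < (2 : R) ^+ j by rewrite exprn_gt0.
  have c0 : 0 < c j by rewrite (lt_le_trans ltr01)// scale_root_ge1.
  have l0 : 0 < e / 2 * (2 ^+ j * pi j) by rewrite !mulr_gt0// invr_gt0.
  apply: (@law_le_reflect _ [set a | exceeds (M j) (e / 2 * (2 ^+ j * pi j))
      (2 ^ (j + 2)) b 0 ((a 0%N)%:R + 0)^-1 (fun i => a i.+1)]).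
  have E0 : 0 <= C1 * (c j ^+ 4)^-1 + C2 * (2 ^+ j)^-1.
    by rewrite addr_ge0// mulr_ge0// invr_ge0 exprn_ge0// ltW.
  apply: (law_le_behead (S := fun k => [set a | exceeds (M j)
     (e / 2 * (2 ^+ j * pi j)) (2 ^ (j + 2)) b 0 (k%:R + 0)^-1 a])) => // k.
  rewrite next_state0; have z01 : 0 <= (0 : R) <= 1 by lra.
  apply: (law_le_mono (next_itv k z01)); last first.
    exact: exceeds_law_le l0 (next_itv k z01).
  rewrite expr0n add0r natrX exprD.
  have Mj : (M j)%:R * c j ^+ 4 <= 36 * (2 ^+ j * pi j ^+ 2).
    have /andP[_ Mc] := threshold_itv j.
    apply: (le_trans (ler_wpM2r (exprn_ge0 4 (ltW c0)) Mc)).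
    rewrite -[leLHS]mulrA [leRHS]mulrCA ler_wpM2l ?exprn_ge0//.
    rewrite -exprD (_ : (2 + 4)%N = (3 * 2)%N)// exprM.
    have := limit_mean_ge j; have : 0 <= c j ^+ 3 by rewrite exprn_ge0// ltW.
    by move: (c j ^+ 3) => C C0 h; nra.
  have sv : step_var R (M j) <= 4 * (M j)%:R + 2 * 217 ^+ 2 * pi j ^+ 2.
    rewrite /step_var lerD2l -mulrA ler_wpM2l// -exprMn.
    have := lip_cap_le j; have := lip_cap_gt0 R (M j) => L0 Lp.
    by apply: lerXn2r; rewrite ?nnegrE; lra.
  set P := 2 ^+ j in P0 Mj *; set p := pi j in p0 Mj sv *.
  set m := (M j)%:R in Mj sv *; set v := step_var _ _ in sv *.
  rewrite ler_pdivrMr ?exprn_gt0//.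
  (* The constants come from M <= 2^j c^2, pi >= c^3/6 and L <= 9 pi. *)
  rewrite [leRHS](_ : _ = P * 4 * (144 * (P * p ^+ 2) / c j ^+ 4
      + 2 * 217 ^+ 2 * p ^+ 2)); last first.
    by rewrite /C1 /C2; field; do ?(apply/andP; split); apply: lt0r_neq0.
  rewrite (_ : 2 ^+ 2 = 4); last by ring.
  rewrite ler_wpM2l ?mulr_ge0 ?(ltW P0)//.
  apply: (le_trans sv); rewrite lerD2r ler_pdivlMr ?exprn_gt0//.
  by move: Mj; lra.
move=> n; rewrite big_split /= -!mulr_sumr.
by apply: lerD; apply: ler_wpM2l => //; [exact: scale_root_sum|exact: half_power_sum].
Qed.

Lemma two_large_negligible :
  (@lebesgue_measure R).-negligible
    [set x : R | forall J, exists2 j, (J <= j)%N & irr01 (1 - x) /\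
       let a := gauss_seq (1 - x) in
       (2 <= \sum_(i < 2 ^ (j + 2)) (M j < a i.+1))%N].
Proof.
apply: (@limsup_negligible _ _
  (fun j => 256 * (c j ^+ 4)^-1) (256 * 4)); last first.
  by move=> n; rewrite -mulr_sumr; apply: (ler_wpM2l (ler0n _ _)); exact: scale_root_sum.
move=> j.
have c0 : 0 < c j by rewrite (lt_le_trans ltr01)// scale_root_ge1.
apply: (@law_le_reflect _ [set a : nat -> nat |
  (2 <= \sum_(i < 2 ^ (j + 2)) (M j < a i.+1))%N]).
have E0 : 0 <= 256 * (c j ^+ 4)^-1.
  by apply: (mulr_ge0 (ler0n _ _)); rewrite invr_ge0 exprn_ge0// ltW.
apply: (law_le_behead (S := fun=> [set a : nat -> nat |
  (2 <= \sum_(i < 2 ^ (j + 2)) (M j < a i))%N])) => // k.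
have z01 : 0 <= (0 : R) <= 1 by lra.
have M0 : (0 < M j)%N by rewrite (leq_trans _ (threshold_ge_pow j))// expn_gt0.
apply: (law_le_mono (next_itv k z01)); last first.
  exact: digit_count_le M0 (next_itv k z01).
have /andP[Mc _] := threshold_itv j.
have M0' : 0 < (M j)%:R :> R by rewrite ltr0n.
have P0 : 0 < (2 : R) ^+ j by rewrite exprn_gt0.
have -> : 256 * (c j ^+ 4)^-1 = (16 / c j ^+ 2) ^+ 2 :> R.
  by field; apply: lt0r_neq0.
rewrite ler_pXn2r ?nnegrE ?divr_ge0 ?mulr_ge0 ?exprn_ge0 ?invr_ge0 ?ler0n ?(ltW c0)//.
rewrite natrX exprD (_ : 2 ^+ 2 = 4); last by ring.
rewrite mulrA ler_pdivrMr// [leRHS]mulrAC ler_pdivlMr ?exprn_gt0//.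
move: Mc; set C := c j ^+ 2; set P := 2 ^+ j; set m := _%:R; nra.
Qed.

(** A deviation must be excluded for each tolerance e; it is enough to do it for
    the countably many tolerances 1/(q+1). *)
Lemma atypical_negligible :
  (@lebesgue_measure R).-negligible
    [set x : R | irr01 (1 - x) /\ ~ typical_digits (fun i => gauss_seq (1 - x) i.+1)].
Proof.
pose N1 (q : nat) (b : bool) := [set x : R | forall J, exists2 j, (J <= j)%N &
  irr01 (1 - x) /\ let a := gauss_seq (1 - x) in
  exceeds (M j) (q.+1%:R^-1 / 2 * (2 ^+ j * pi j)) (2 ^ (j + 2)) b 0
     ((a 0%N)%:R + 0)^-1 (fun i => a i.+1)].
pose N2 := [set x : R | forall J, exists2 j, (J <= j)%N & irr01 (1 - x) /\
  let a := gauss_seq (1 - x) in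
  (2 <= \sum_(i < 2 ^ (j + 2)) (M j < a i.+1))%N].
have sub : [set x : R | irr01 (1 - x) /\
      ~ typical_digits (fun i => gauss_seq (1 - x) i.+1)] `<=`
    (\bigcup_q (N1 q true `|` N1 q false)) `|` N2.
  move=> x [xi nt]; apply: contrapT => nN; apply: nt; split; last first.
    apply: contrapT => nJ; apply: nN; right => J.
    apply: contrapT => nj; apply: nJ; exists J => j Jj.
    by rewrite leqNgt; apply/negP => h; apply: nj; exists j.
  move=> e e0.
  have [q qe] : exists q : nat, q.+1%:R^-1 < e :> R.
    exists (Num.truncn e^-1); rewrite invf_plt ?posrE ?ltr0n//.
    exact: truncnS_gt.
  have [J hJ] : exists J, forall j b, (J <= j)%N ->
      ~ exceeds (M j) (q.+1%:R^-1 / 2 * (2 ^+ j * pi j)) (2 ^ (j + 2)) b 0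
     ((gauss_seq (1 - x) 0%N)%:R + 0)^-1 (fun i => gauss_seq (1 - x) i.+1).
    have hb b : exists J, forall j, (J <= j)%N ->
        ~ exceeds (M j) (q.+1%:R^-1 / 2 * (2 ^+ j * pi j)) (2 ^ (j + 2)) b 0
        ((gauss_seq (1 - x) 0%N)%:R + 0)^-1 (fun i => gauss_seq (1 - x) i.+1).
      apply: contrapT => nJ; apply: nN; left; exists q => //.
      suff : N1 q b x by case: (b); [left|right].
      move=> J; apply: contrapT => nj; apply: nJ; exists J => j Jj ex.
      by apply: nj; exists j.
    have [J1 h1] := hb true; have [J2 h2] := hb false.
    exists (maxn J1 J2) => j b; rewrite geq_max => /andP[j1 j2].
    by case: b; [exact: h1|exact: h2].
  exists (maxn J (Num.truncn (432 * q.+1%:R : R))) => j b k.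
  rewrite geq_max => /andP[Jj qj] kr.
  have z01 : 0 <= (0 : R) <= 1 by lra.
  have a0 i : (0 < gauss_seq (1 - x) i)%N.
    by apply/gauss_digit_gt0/iter_gauss_irr.
  have s01 : 0 <= ((gauss_seq (1 - x) 0%N)%:R + 0 : R)^-1 <= 1.
    by rewrite -(prednK (a0 0%N)) next_state0; exact: next_itv.
  have := exceedsN_bound s01 (fun i => a0 i.+1) (hJ j b Jj) kr.
  have := drift_norm (M j) (2 ^ (j + 2)) b s01.
  have p0 := limit_mean_gt0 j; have Lp := lip_cap_le j.
  have P0 : 0 < (2 : R) ^+ j by rewrite exprn_gt0.
  have q0 : 0 < q.+1%:R^-1 :> R by rewrite invr_gt0 ltr0n.
  (* Half of the tolerance is for the martingale, half for the two drifts by which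
     it differs from the centered sum. *)
  have hL : 24 * (9 * pi j) <= q.+1%:R^-1 / 2 * (2 ^+ j * pi j).
    rewrite !mulrA ler_wpM2r ?(ltW p0)//.
    have : 432 * q.+1%:R <= 2 ^+ j :> R.
      rewrite ltW//; apply: (lt_le_trans (truncnS_gt _)).
      rewrite -natrX ler_nat; apply: (leq_ltn_trans qj); exact: ltn_expl.
    rewrite -ler_pdivlMr ?ltr0n//; move: (2 ^+ j) (q.+1%:R^-1) => P qi; lra.
  have eq : q.+1%:R^-1 * (2 ^+ j * pi j) <= e * (2 ^+ j * pi j).
    by rewrite ler_wpM2r ?mulr_ge0 ?(ltW P0) ?(ltW p0)// ltW.
  rewrite add0r => d1 d2; apply: le_trans eq.
  move: d1 d2 hL; rewrite ltr_norml !ler_norml.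
  move: (2 ^+ j * pi j) (q.+1%:R^-1) (drift _ _ _ _) => W qi d.
  by move=> /andP[? ?] /andP[? ?] ?; apply/andP; split; lra.
apply: (@negligibleS _ _ _ (@lebesgue_measure R) _ _ sub).
apply: (@negligibleU _ _ _ (@lebesgue_measure R)); last exact: two_large_negligible.
apply: (@negligible_bigcup _ _ _ (@lebesgue_measure R)) => q.
have q0 : 0 < q.+1%:R^-1 :> R by rewrite invr_gt0 ltr0n.
by apply: (@negligibleU _ _ _ (@lebesgue_measure R)); exact: deviation_negligible.
Qed.

End Scales.

(** * The backward map seen through the Gauss map *)

Section BackwardMap.
Context (R : realType).
Implicit Types (x z g : R).

Local Notation T := (@T_BCF R).

Definition bcf_first (x : R) : nat := (Num.truncn (1 / (1 - x))).+1.

Lemma frac_truncn (y : R) : 0 <= y -> Defs.frac y = y - (Num.truncn y)%:R.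
Proof.
move=> y0; rewrite /Defs.frac truncn_floor y0 natr_absz ger0_norm//.
by rewrite floor_ge0.
Qed.

Lemma T_BCF_gauss x : irr01 (1 - x) -> T x = gauss_map (1 - x).
Proof.
move=> [/andP[x0 x1] _]; rewrite /T_BCF frac_truncn ?divr_ge0 ?(ltW x0)//.
by rewrite /gauss_map /gauss_digit div1r.
Qed.

(** With v = 1/(n+g), the quantity 1/(1-v) is 1 + 1/(n-1+g), so for n >= 2 the
    orbit moves one step along its block. *)
Lemma T_BCF_shift n g : irr01 g ->
  T (n.+2%:R + g)^-1 = (n.+1%:R + g)^-1 /\
  bcf_first (n.+2%:R + g)^-1 = 2%N /\
  ~ `[1 / 2, 1]%classic (n.+2%:R + g)^-1.
Proof.
move=> [/andP[g0 g1] _]; rewrite -(natr1 n.+1).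
have : 1 <= n.+1%:R :> R by rewrite ler1n.
set K := _%:R => K1.
have E : 1 / (1 - (K + 1 + g)^-1) = 1 + (K + g)^-1.
  by field; do ?(apply/andP; split); apply: lt0r_neq0; lra.
have i0 : 0 < (K + g)^-1 by rewrite invr_gt0; lra.
have i1 : (K + g)^-1 < 1 by rewrite invf_lt1; lra.
have tr : Num.truncn (1 + (K + g)^-1) = 1%N.
  by apply: truncn_def; rewrite -natr1; lra.
split; last split.
- by rewrite /T_BCF E frac_truncn ?tr; [ring|lra].
- by rewrite /bcf_first E tr.
- rewrite /= in_itv /= => /andP[+ _].
  apply/negP; rewrite -ltNge div1r ltf_pV2 ?posrE; lra.
Qed.

Lemma T_BCF_return g : irr01 g ->
  T (1 + g)^-1 = gauss_map g /\
  bcf_first (1 + g)^-1 = (gauss_digit g).+2 /\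
  `[1 / 2, 1]%classic (1 + g)^-1.
Proof.
move=> gi; have [/andP[g0 g1] _] := gi.
(* Here v = 1/(1+g) is the last step of a block. *)
have E : 1 / (1 - (1 + g)^-1) = 1 + g^-1.
  by field; do ?(apply/andP; split); apply: lt0r_neq0; lra.
have /andP[d0 d1] := gauss_digit_itv gi.
have tr : Num.truncn (1 + g^-1) = (gauss_digit g).+1.
  by apply: truncn_def; move: d0 d1; rewrite -!natr1; lra.
have i0 : 0 < g^-1 by rewrite invr_gt0.
split; last split.
- by rewrite /T_BCF E frac_truncn ?tr ?/gauss_map -?natr1; [ring|lra].
- by rewrite /bcf_first E tr.
- rewrite /= in_itv /= div1r lef_pV2 ?posrE ?invf_le1; lra.
Qed.

Lemma iter_T_BCF_block z j : irr01 z -> (j < gauss_digit z)%N ->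
  iter j T z = ((gauss_digit z - j)%:R + gauss_map z)^-1.
Proof.
move=> zi; elim: j => [|j IH] jd; first by rewrite subn0 gauss_mapK.
rewrite iterS IH; last exact: ltnW.
have -> : (gauss_digit z - j)%N = (gauss_digit z - j.+2).+2 by lia.
rewrite (T_BCF_shift _ (gauss_map_irr zi)).1.
by congr ((_%:R + _)^-1); lia.
Qed.

Lemma iter_T_BCF_digit z : irr01 z ->
  iter (gauss_digit z) T z = gauss_map (gauss_map z).
Proof.
move=> zi; have d0 := gauss_digit_gt0 zi.
rewrite -(prednK d0) iterS iter_T_BCF_block//; last by rewrite prednK.
have -> : (gauss_digit z - (gauss_digit z).-1)%N = 1%N by lia.
exact: (T_BCF_return (gauss_map_irr zi)).1.
Qed.

(** Number of steps of the backward map in the first n blocks. *)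
Definition block_start (a : nat -> nat) (n : nat) : nat := \sum_(i < n) a i.*2.

Lemma iter_T_BCF_block_start z n : irr01 z ->
  iter (block_start (gauss_seq z) n) T z = iter n.*2 (@gauss_map R) z.
Proof.
move=> zi; elim: n => [|n IH]; first by rewrite /block_start big_ord0.
rewrite /block_start big_ord_recr /= addnC iterD IH.
by rewrite [gauss_seq z n.*2]/gauss_seq iter_T_BCF_digit//; exact: iter_gauss_irr.
Qed.

Lemma orbit_in_block z n j : irr01 z -> (j < gauss_seq z n.*2)%N ->
  let v := iter (block_start (gauss_seq z) n + j) T z in
  bcf_first v =
    (if j.+1 == gauss_seq z n.*2 then (gauss_seq z n.*2.+1).+2 else 2%N) /\
  (`[1 / 2, 1]%classic v <-> j.+1 = gauss_seq z n.*2).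
Proof.
move=> zi jd v; set w := iter n.*2 (@gauss_map R) z.
have wi : irr01 w by exact: iter_gauss_irr.
have gi := gauss_map_irr wi.
have vE : v = ((gauss_digit w - j)%:R + gauss_map w)^-1.
  by rewrite /v addnC iterD iter_T_BCF_block_start// iter_T_BCF_block.
have dE : gauss_seq z n.*2 = gauss_digit w by [].
have dE' : gauss_seq z n.*2.+1 = gauss_digit (gauss_map w) by [].
move: jd; rewrite dE dE' vE leq_eqVlt => /orP[/eqP jd|jd].
  have -> : (gauss_digit w - j)%N = 1%N by lia.
  have [_ [-> vE1]] := T_BCF_return gi.
  by rewrite jd eqxx.
have -> : (gauss_digit w - j)%N = (gauss_digit w - j.+2).+2 by lia.
have [_ [-> nE]] := T_BCF_shift (gauss_digit w - j.+2) gi.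
rewrite ltn_eqF//; split => // ; split => // jE.
by move: jd; rewrite jE ltnn.
Qed.

Lemma T_BCF_itv x : 0 <= x < 1 -> 0 <= T x < 1.
Proof.
move=> /andP[x0 x1].
have h : 0 <= 1 / (1 - x) by rewrite divr_ge0//; lra.
have := truncn_itv h.
by rewrite /T_BCF frac_truncn// -natr1; lra.
Qed.

Lemma bcf_firstE x : 0 <= x < 1 ->
  (bcf_first x)%:R - (1 - T x) = (1 - x)^-1.
Proof.
move=> /andP[x0 x1].
have h : 0 <= 1 / (1 - x) by rewrite divr_ge0//; lra.
rewrite /T_BCF frac_truncn// /bcf_first -natr1 -[in RHS]div1r; ring.
Qed.

Lemma bcf_first_ge2 x : 0 <= x < 1 -> (2 <= bcf_first x)%N.
Proof.
move=> /andP[x0 x1]; rewrite /bcf_first ltnS truncn_gt0 div1r.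
by rewrite invf_ge1; lra.
Qed.

(** The truncated expansion replaces an inner tail y' by 0. As d >= 2 and y' <= 1,
    one level sends an error e to at most e/(1+e), and iterating this from an
    error at most 1 gives 1/(n+1). The digit 2 alone attains this rate, so there
    is no geometric convergence. *)
Lemma bcf_tail_close x j n : 0 <= x < 1 ->
  let y := 1 - iter j T x in
  0 <= bcf_tail R (bcf_digit x) j.+1 n <= y /\
  y - bcf_tail R (bcf_digit x) j.+1 n <= n.+1%:R^-1.
Proof.
move=> x01; elim: n j => [|n IH] j /=.
  have : 0 <= iter j T x < 1 by elim: j => //= j; exact: T_BCF_itv.
  by rewrite invr1; lra.
have j01 : 0 <= iter j T x < 1 by elim: j => //= j; exact: T_BCF_itv.
have := IH j.+1; rewrite /= => -[].
have := T_BCF_itv j01.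
set v := bcf_tail _ _ _ _; set y' := 1 - T _ => y01 /andP[v0 vy] vn.
have dE : (bcf_digit x j.+1)%:R - y' = (1 - iter j T x)^-1.
  by rewrite -bcf_firstE.
have d2 : 2 <= (bcf_digit x j.+1)%:R :> R.
  by rewrite ler_nat; exact: bcf_first_ge2.
set d := _%:R in dE d2 *.
have -> : 1 - iter j T x = (d - y')^-1 by rewrite dE invrK.
have y'1 : y' <= 1 by rewrite /y'; lra.
have n0 : 0 < n.+1%:R :> R by rewrite ltr0n.
rewrite div1r invr_ge0 lef_pV2 ?posrE; try lra.
split; first lra.
have -> : (d - y')^-1 - (d - v)^-1 = (y' - v) / ((d - y') * (d - v)).
  by field; apply/andP; split; apply: lt0r_neq0; lra.
have e0 : 0 <= y' - v by lra.
(* Since d - y' >= 1 and d - v = (d - y') + (y' - v). *)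
have p0 : 1 + (y' - v) <= (d - y') * (d - v) by nra.
rewrite ler_pdivrMr; last lra.
rewrite -(natr1 n.+1) ler_pdivlMl; last lra.
have : n.+1%:R * (y' - v) <= 1 by rewrite -ler_pdivlMl// mulr1.
by lra.
Qed.

Lemma bcf_expansion x : 0 <= x < 1 -> is_bcf_expansion (bcf_digit x) x.
Proof.
move=> x01; split.
  move=> [//|j] _; apply: bcf_first_ge2.
  by elim: j => //= j; exact: T_BCF_itv.
have h n := bcf_tail_close 0 n x01.
apply: (@squeeze_cvgr _ _ _ _ (fun=> x) (fun n => x + harmonic n)).
- apply: nearW => n; have [/andP[_]] := h n.
  rewrite /harmonic /=; move: (bcf_tail _ _ _ _) (_^-1) => u v ? ?.
  by apply/andP; split; lra.
- exact: cvg_cst.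
- rewrite -[X in _ --> X]addr0; apply: cvgD; first exact: cvg_cst.
  exact: cvg_harmonic.
Qed.

End BackwardMap.

(** * Counting along blocks *)

Section Blocks.
Local Open Scope nat_scope.
Context (a : nat -> nat) (a_gt0 : forall i, 0 < a i).
Local Notation tau := (block_start a).

Lemma block_startS n : tau n.+1 = tau n + a n.*2.
Proof. by rewrite /block_start big_ord_recr. Qed.

Lemma block_start_lt n : tau n < tau n.+1.
Proof. by rewrite block_startS -[X in X < _]addn0 ltn_add2l. Qed.

Lemma block_start_le n k : n <= k -> tau n <= tau k.
Proof.
move=> nk; rewrite -(subnKC nk) /block_start big_split_ord /=.
exact: leq_addr.
Qed.

Lemma block_exists t : exists n, tau n <= t < tau n.+1.
Proof.
elim: t => [|t [n /andP[nt tn]]].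
  by exists 0; rewrite block_startS /block_start big_ord0 add0n a_gt0.
have [h|h] := ltnP t.+1 (tau n.+1); first by exists n; rewrite h ltnW.
exists n.+1; rewrite h /=; apply: leq_trans (block_start_lt n.+1).
by rewrite ltnS.
Qed.

Lemma block_le n k t : tau n <= t -> t < tau k.+1 -> n <= k.
Proof.
move=> nt tk; rewrite leqNgt; apply/negP => kn.
by have := leq_trans tk (leq_trans (block_start_le kn) nt); rewrite ltnn.
Qed.

Lemma cap_sum (f : nat -> nat) M n : (forall i, i < n -> f i <= M) ->
  \sum_(i < n) f i = \sum_(i < n) cap M (f i).
Proof. by move=> h; apply: eq_bigr => i _; rewrite /cap h. Qed.

Lemma cap_sum_one (f : nat -> nat) M n k : k < n -> M < f k ->
  (forall i, i < n -> M < f i -> i = k) ->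
  \sum_(i < n) f i = \sum_(i < n) cap M (f i) + f k.
Proof.
move=> kn Mk h; rewrite (bigD1 (Ordinal kn)) //= addnC.
rewrite [in RHS](bigD1 (Ordinal kn)) //=.
rewrite [cap M (f k)]/cap [f k <= M]leqNgt Mk add0n.
congr (_ + _); apply: eq_bigr => i ik; rewrite /cap ifT// leqNgt.
by apply: contra ik => /h-/(_ (ltn_ord i)) ik; apply/eqP/val_inj.
Qed.

Lemma count_le1 (M k : nat) : \sum_(i < k) (M < a i) <= 1 ->
  forall i j, i < k -> j < k -> M < a i -> M < a j -> i = j.
Proof.
move=> h i j ik jk Mi Mj; apply/eqP; apply: contraTT h => ij.
rewrite -ltnNge (bigD1 (Ordinal ik)) //= (bigD1 (Ordinal jk)) /=; last first.
  by apply: contra ij => /eqP[->].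
by rewrite Mi Mj.
Qed.

Section Window.
Context (M N m n0 n1 : nat).
Context (N0 : tau n0 <= N < tau n0.+1) (mE : m = \max_(i < n0.+1) a i.*2).
Context (N1 : tau n1 <= N + m - 1 < tau n1.+1).
Context (large1 : forall i j, i < (n1.+1).*2 -> j < (n1.+1).*2 ->
  M < a i -> M < a j -> i = j).

Lemma longest_block_ge i : i <= n0 -> a i.*2 <= m.
Proof.
move=> i0; rewrite mE.
exact: (@leq_bigmax _ (fun i : 'I_n0.+1 => a i.*2)
  (Ordinal (i0 : i < n0.+1))).
Qed.

Lemma longest_block_attained : exists2 i, i <= n0 & m = a i.*2.
Proof.
have c0 : 0 < #|'I_n0.+1| by rewrite card_ord.
have [i iE] := @bigop.eq_bigmax _ (fun i : 'I_n0.+1 => a i.*2) c0.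
by exists i; rewrite ?mE// -ltnS.
Qed.

Lemma longest_block_gt0 : 0 < m.
Proof. exact: leq_trans (a_gt0 _) (longest_block_ge (leq0n n0)). Qed.

Lemma window_blocks : n0 <= n1.
Proof.
apply: (@block_le _ _ (N + m - 1)); last by case/andP: N1.
case/andP: N0 => h _; apply: (leq_trans h).
by have := longest_block_gt0; lia.
Qed.

Let evens := \sum_(i < n1) cap M (a i.*2).
Let odds := \sum_(i < n1) cap M (a i.*2.+1).

(** The even digits of the blocks completed by time N + m - 1 add up to N + m, up
    to the unfinished block. If m > M, then m is the only large even digit, and
    removing it leaves N. If m <= M, no large even digit is completed: its block
    would start after N and last more than M >= m steps. In both cases N is the
    truncated even sum up to 2 M. *)
Lemma even_window : N <= evens + 2 * M /\ evens <= N + 2 * M.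
Proof.
have n01 := window_blocks; have m0 := longest_block_gt0.
case/andP: N0 => N0a N0b; case/andP: N1 => N1a N1b.
have tauS := block_startS n1.
have uniq_even i j : i <= n1 -> j <= n1 -> M < a i.*2 -> M < a j.*2 -> i = j.
  move=> i1 j1 Mi Mj; have := @large1 i.*2 j.*2.
  rewrite !ltn_double !ltnS => /(_ i1 j1 Mi Mj); lia.
have tau1 : tau n1 = \sum_(i < n1) a i.*2 by [].
case: (leqP m M) => mM.
  have small i : i < n1 -> a i.*2 <= M.
    move=> i1; rewrite leqNgt; apply/negP => Mi.
    have i0 : n0 < i.
      rewrite ltnNge; apply/negP => /longest_block_ge; lia.
    have := block_start_le i1; rewrite block_startS.
    have := block_start_le i0; lia.
  rewrite (@cap_sum (fun i => a i.*2) M n1 small) in tau1.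
  rewrite -/evens in tau1.
  case: (leqP (a n1.*2) M) => Mn; first lia.
  have n0n : n0 < n1.
    rewrite ltn_neqAle n01 andbT; apply/eqP => n0n.
    by have := @longest_block_ge n1; rewrite n0n => /(_ (leqnn _)); lia.
  by have := block_start_le n0n; lia.
have [i i0 mi] := longest_block_attained.
have Mi : M < a i.*2 by rewrite -mi.
have i1 : i <= n1 by exact: leq_trans n01.
have [in1|in1] := ltnP i n1.
  have n1M : a n1.*2 <= M.
    by rewrite leqNgt; apply/negP => /uniq_even-/(_ _ (leqnn _) i1 Mi); lia.
  rewrite (@cap_sum_one (fun i => a i.*2) M n1 i) // in tau1; last first.
    by move=> k k1 Mk; apply: uniq_even => //; exact: ltnW.
  by rewrite -/evens -mi in tau1; lia.
have iE : i = n1 by lia.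
have n0E : n0 = n1 by lia.
rewrite (@cap_sum (fun i => a i.*2) M n1) in tau1; last first.
  move=> k k1; rewrite leqNgt; apply/negP => Mk.
  have := uniq_even k i (ltnW k1) i1 Mk Mi; lia.
by rewrite -/evens in tau1; subst n0 i; lia.
Qed.

Context (d1 D : nat) (D_ge : 2 * m <= D).
Context (D_attained : forall i, i < n1 -> a i.*2.+1 + 2 <= D).
Context (D_le : forall v, (forall i, i < n1 -> a i.*2.+1 <= v) ->
  D <= 2 * m + (v + 2) + d1).

(** If an odd digit is large, then it is the largest backward digit (up to 2) and
    m <= M. If none is, all backward digits but the first are at most M + 2, and
    2 m is the maximum up to that error. *)
Lemma odd_window :
  \sum_(i < n1) a i.*2.+1 + 2 * m <= odds + D + (2 * M + 2 + d1) /\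
  odds + D <= \sum_(i < n1) a i.*2.+1 + 2 * m + (2 * M + 2 + d1).
Proof.
have n01 := window_blocks.
have uniq_odd i j : i < n1 -> j < n1 -> M < a i.*2.+1 -> M < a j.*2.+1 -> i = j.
  move=> i1 j1 Mi Mj; have := @large1 i.*2.+1 j.*2.+1.
  have -> : i.*2.+1 < n1.+1.*2 by lia.
  have -> : j.*2.+1 < n1.+1.*2 by lia.
  by move=> /(_ isT isT Mi Mj); lia.
have [/existsP[i Mi]|/existsPn small] :=
    boolP [exists i : 'I_n1, M < a i.*2.+1].
  have other k : k < n1 -> M < a k.*2.+1 -> k = i.
    by move=> k1 Mk; exact: uniq_odd.
  have mM : m <= M.
    have [k k0 ->] := longest_block_attained.
    rewrite leqNgt; apply/negP => Mk; have i1 := ltn_ord i.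
    have := @large1 k.*2 i.*2.+1; rewrite ltn_double ltnS (leq_trans k0 n01).
    have -> : i.*2.+1 < n1.+1.*2 by lia.
    by move=> /(_ isT isT Mk Mi) e; have := congr1 odd e; rewrite /= !odd_double.
  rewrite (@cap_sum_one (fun i => a i.*2.+1) M n1 i) // -/odds.
  have := D_attained (ltn_ord i).
  have := @D_le (a i.*2.+1).
  have h k : k < n1 -> a k.*2.+1 <= a i.*2.+1.
    move=> k1; case: (leqP (a k.*2.+1) M) => Mk; first by rewrite ltnW// (leq_ltn_trans Mk).
    by rewrite (other k).
  by move=> /(_ h); lia.
have small' i : i < n1 -> a i.*2.+1 <= M.
  by move=> i1; have := small (Ordinal i1); rewrite -leqNgt.
rewrite (@cap_sum (fun i => a i.*2.+1) M n1) // -/odds.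
by have := D_le small'; lia.
Qed.

End Window.

Section Orbit.
Context (X : Type) (T : X -> X) (E : set X) (dig : X -> nat) (x : X).
Context (orbit : forall n j, j < a n.*2 ->
  let v := iter (tau n + j).+1 T x in
  dig v = (if j.+1 == a n.*2 then (a n.*2.+1).+2 else 2) /\
  (E v <-> j.+1 = a n.*2)).

Lemma block_split t n : tau n <= t < tau n.+1 ->
  exists2 j, j < a n.*2 & t = tau n + j.
Proof.
rewrite block_startS => /andP[h1 h2]; exists (t - tau n); last by lia.
by rewrite ltn_subLR.
Qed.

(** An excursion begun at some time is over at the last step of its block, and the
    longest one starts at the beginning of a block: its length is the number of
    steps of the block minus 1, which the 1 in longest_excursion compensates. When
    all blocks seen so far have one step, there is no excursion and both sides
    are 1. *)
Lemma longest_excursionE N n0 : tau n0 <= N < tau n0.+1 ->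
  longest_excursion T N E x = \max_(i < n0.+1) a i.*2.
Proof.
move=> N0; have [Na Nb] := andP N0.
set m := \max_(i < n0.+1) _.
have mE : m = \max_(i < n0.+1) a i.*2 by [].
rewrite /longest_excursion; set S := [set k | _].
have m0 := longest_block_gt0 mE.
have ub k : S k -> k <= m.-1.
  move=> [k1 [l [/andP[l1 lN] hl]]].
  have [n /andP[n1 n2]] := block_exists l.-1.
  have [|j jn lE] := @block_split l.-1 n; first by rewrite n1.
  have nn0 : n <= n0 by apply: block_le n1 _; lia.
  have am := longest_block_ge mE nn0.
  suff : k < a n.*2 by lia.
  rewrite ltnNge; apply/negP => ak.
  have jk : a n.*2 - j.+1 < k by lia.
  apply: (hl _ jk).
  have an : (a n.*2).-1 < a n.*2 by rewrite prednK.
  have [_ [_ h]] := orbit an.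
  have -> : l + (a n.*2 - j.+1) = (tau n + (a n.*2).-1).+1 by lia.
  by apply: h; rewrite prednK.
suff -> : max_nat S = m.-1 by rewrite add1n prednK.
have [m1|m1] := leqP m 1.
  have mE1 : m = 1 by lia.
  rewrite /max_nat mE1 /=; case: xgetP => // k _ [Sk _].
  by have := ub _ Sk; case: Sk => k1 _; rewrite mE1; lia.
have Sm : S m.-1.
  split; first by lia.
  have [i i0 mi] := longest_block_attained mE.
  exists (tau i).+1; split.
    by have := block_start_le i0; lia.
  move=> j jm; rewrite addSn; have ji : j < a i.*2 by lia.
  by have [_ [h _]] := orbit ji; move/h; lia.
apply: xget_unique; first by split.
move=> k [Sk hk]; apply/eqP; rewrite eqn_leq.
by rewrite ub//= hk.
Qed.

(** Each step contributes 2, and the end of a block adds the odd digit. *)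
Lemma digit_sum t n : tau n <= t < tau n.+1 ->
  \sum_(u < t) dig (iter u.+1 T x) = 2 * t + \sum_(i < n) a i.*2.+1.
Proof.
elim: t n => [|t IH] n tn.
  have -> : n = 0.
    by apply/eqP; rewrite -leqn0; apply: (@block_le _ _ 0);
      [case/andP: tn|rewrite block_startS addn_gt0 a_gt0 orbT].
  by rewrite !big_ord0.
have [k kt] := block_exists t.
rewrite big_ord_recr /= (IH k kt).
have [j jk tE] := block_split kt.
have := orbit jk; rewrite -tE => -[-> _].
move: kt tn => /andP[k1 k2] /andP[n1 n2].
case: eqP => jE.
  have kt : t.+1 = tau k.+1 by rewrite block_startS; lia.
  have -> : n = k.+1.
    apply/eqP; rewrite eqn_leq; apply/andP; split.
      by apply: block_le n1 _; rewrite kt; exact: block_start_lt.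
    by apply: block_le (eq_leq (esym kt)) n2.
  by rewrite big_ord_recr /=; lia.
have -> : n = k.
  apply/eqP; rewrite eqn_leq; apply/andP; split.
    by apply: block_le n1 _; rewrite block_startS; lia.
  by apply: block_le k1 _; apply: leq_trans n2.
by rewrite mulnS addnC addnA.
Qed.

Lemma digit_le t n v : tau n <= t < tau n.+1 ->
  (forall i, i < n -> a i.*2.+1 <= v) ->
  forall u, u < t -> dig (iter u.+1 T x) <= v + 2.
Proof.
move=> /andP[n1 n2] hv u ut.
have [k kt] := block_exists u; have [j jk uE] := block_split kt.
have := orbit jk; rewrite -uE => -[-> _]; case: eqP => jE; last by lia.
rewrite -addn2 leq_add2r; apply: hv.
have k1 : tau k.+1 = u.+1 by rewrite block_startS; lia.
rewrite -ltnS; apply: (@leq_ltn_trans n); last by [].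
by apply: block_le n2; rewrite k1.
Qed.

Lemma digit_attained t n i : tau n <= t -> i < n ->
  exists2 u, u < t & dig (iter u.+1 T x) = a i.*2.+1 + 2.
Proof.
move=> nt iN; exists (tau i + (a i.*2).-1).
  apply: leq_trans nt; apply: leq_trans (block_start_le iN).
  by rewrite block_startS -addnS prednK.
have an : (a i.*2).-1 < a i.*2 by rewrite prednK.
by have [-> _] := orbit an; rewrite prednK// eqxx addn2.
Qed.

End Orbit.

End Blocks.

(** * The limit *)

Lemma sum_even_indices (R : realType) (g : nat -> R) n :
  \sum_(i < n.*2) (true (+) odd i)%:R * g i = \sum_(i < n) g i.*2.
Proof.
elim: n => [|n IH]; first by rewrite !big_ord0.
rewrite doubleS !big_ord_recr /= IH odd_double /=.
by rewrite mul1r mul0r addr0.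
Qed.

Lemma sum_odd_indices (R : realType) (g : nat -> R) n :
  \sum_(i < n.*2) (false (+) odd i)%:R * g i = \sum_(i < n) g i.*2.+1.
Proof.
elim: n => [|n IH]; first by rewrite !big_ord0.
rewrite doubleS !big_ord_recr /= IH odd_double /=.
by rewrite mul0r mul1r addr0.
Qed.

Lemma digit_sum_shift (c N m s : nat) : (0 < m)%N ->
  (c + (2 * (N + m - 1) + s) + 2 = c + 2 * N + 2 * m + s)%N.
Proof. lia. Qed.

(** With W = 2^j pi_j, each of the errors below is at most a small multiple of W:
    the two deviations of the truncated sums, the truncation level M_j, and the
    first digit d1; and N is at least W/2. The total is at most 7 e1 W, whence the
    choice of e1. *)
Lemma typical_balance (R : realType) (a : nat -> nat) (d1 : nat) (e : R) :
  (forall i, (0 < a i)%N) -> typical_digits R a -> 0 < e ->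
  exists N_ : nat, forall N m n0 n1 D : nat, (N_ <= N)%N ->
    (block_start a n0 <= N < block_start a n0.+1)%N ->
    m = (\max_(i < n0.+1) a i.*2)%N ->
    (block_start a n1 <= N + m - 1 < block_start a n1.+1)%N ->
    (2 * m <= D)%N ->
    (forall i, (i < n1)%N -> (a i.*2.+1 + 2 <= D)%N) ->
    (forall v, (forall i, (i < n1)%N -> (a i.*2.+1 <= v)%N) ->
       (D <= 2 * m + (v + 2) + d1)%N) ->
    `|(d1 + (2 * (N + m - 1) + \sum_(i < n1) a i.*2.+1))%N%:R - D%:R
      - 3 * N%:R| <= e * N%:R.
Proof.
move=> a0 [dev [Jc count]] e0.
pose e1 : R := Num.min (1 / 6) (e / 14).
have e10 : 0 < e1 by rewrite lt_min; apply/andP; split; lra.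
have [e1a e1b] : e1 <= 1 / 6 /\ e1 <= e / 14.
  by split; rewrite ge_min lexx ?orbT.
have [Jd hd] := dev e1 e10; have [Jt ht] := threshold_small e10.
pose Jk := Num.truncn (6 * (2 * d1 + 4)%:R / e1).
pose J := maxn (maxn Jc Jd) (maxn Jt Jk).
exists (block_start a (2 ^ J)) => N m n0 n1 D NJ hN0 mE hN1 D_ge D_att D_le.
have n01 : (n0 <= n1)%N by exact: (window_blocks a0 hN0 mE hN1).
have Jn1 : (2 ^ J <= n1)%N.
  by apply: leq_trans n01; apply: (block_le NJ); case/andP: hN0.
have n1_gt0 : (0 < n1)%N by apply: leq_trans Jn1; rewrite expn_gt0.
pose j := trunc_log 2 n1.
have /andP[jn1 n1j] : (2 ^ j <= n1 < 2 ^ j.+1)%N by exact: trunc_log_bounds.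
have Jj : (J <= j)%N by exact: trunc_log_max.
move: Jj; rewrite !geq_max => /andP[/andP[Jcj Jdj] /andP[Jtj Jkj]].
have len : (n1.+1.*2 <= 2 ^ (j + 2))%N.
  by rewrite addn2 expnS mul2n leq_double.
have large1 i k : (i < n1.+1.*2)%N -> (k < n1.+1.*2)%N ->
    (threshold R j < a i)%N -> (threshold R j < a k)%N -> i = k.
  move=> i1 k1; apply: (count_le1 (count j Jcj)).
    exact: leq_trans len.
  exact: leq_trans len.
have [w1 w2] := even_window a0 hN0 mE hN1 large1.
have [w3 w4] := odd_window a0 hN0 mE hN1 large1 D_ge D_att D_le.
move: w1 w2 w3 w4.
set A := (\sum_(i < n1) cap _ (a i.*2))%N.
set B := (\sum_(i < n1) cap _ (a i.*2.+1))%N.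
set So := (\sum_(i < n1) a i.*2.+1)%N.
move=> w1 w2 w3 w4.
set W : R := 2 ^+ j * limit_mean R (threshold R j).
have len' : (n1.*2 <= 2 ^ (j + 2))%N.
  by apply: leq_trans len; rewrite leq_double.
have cap_sumB (f : nat -> nat) :
    \sum_(i < n1) ((cap (threshold R j) (f i))%:R - limit_mean R (threshold R j))
    = (\sum_(i < n1) cap (threshold R j) (f i))%N%:R
      - n1%:R * limit_mean R (threshold R j).
  by rewrite sumrB natr_sum sumr_const card_ord mulr_natl.
have := hd j true n1.*2 Jdj len'.
rewrite (sum_even_indices (fun i => (cap (threshold R j) (a i))%:R - limit_mean R (threshold R j))).
rewrite (cap_sumB (fun i => a i.*2)) -/A -/W => hA.
have := hd j false n1.*2 Jdj len'.
rewrite (sum_odd_indices (fun i => (cap (threshold R j) (a i))%:R - limit_mean R (threshold R j))).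
rewrite (cap_sumB (fun i => a i.*2.+1)) -/B -/W => hB.
have p0 := limit_mean_gt0 R j.
have nW : W <= n1%:R * limit_mean R (threshold R j).
  by rewrite ler_wpM2r ?(ltW p0)// -natrX ler_nat.
have hM := ht j Jtj; rewrite -/W in hM.
have hK : (2 * d1 + 4)%:R <= e1 * W.
  have W6 : (j.+1)%:R / 6 <= W.
    apply: (@le_trans _ _ (limit_mean R (threshold R j))).
      by rewrite -scale_root_cube; exact: limit_mean_ge.
    by rewrite ler_peMl ?(ltW p0)// exprn_ege1// ler1n.
  have h6 : 6 * (2 * d1 + 4)%:R / e1 <= j.+1%:R :> R.
    by rewrite ltW//; apply: (lt_le_trans (truncnS_gt _)); rewrite ler_nat ltnS.
  move: h6; rewrite ler_pdivrMr// => h6.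
  have := ler_wpM2l (ltW e10) W6; lra.
have m0 : (0 < m)%N := longest_block_gt0 a0 mE.
move: (n1%:R * _) nW hA hB => V nW hA hB.
have W0 : 0 <= W by rewrite mulr_ge0 ?exprn_ge0 ?(ltW p0).
have N_ge : W / 2 <= N%:R.
  have : A%:R <= N%:R + 2 * (threshold R j)%:R :> R.
    by rewrite -natrM -natrD ler_nat.
  have := ler_wpM2r W0 e1a.
  by move: hA; rewrite ler_norml; lra.
have w1' : N%:R <= A%:R + 2 * (threshold R j)%:R :> R.
  by rewrite -natrM -natrD ler_nat.
have w2' : A%:R <= N%:R + 2 * (threshold R j)%:R :> R.
  by rewrite -natrM -natrD ler_nat.
have w3' : So%:R + 2 * m%:R <= B%:R + D%:R + (2 * (threshold R j)%:R + 2 + d1%:R) :> R.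
  by rewrite -!natrM -!natrD ler_nat.
have w4' : B%:R + D%:R <= So%:R + 2 * m%:R + (2 * (threshold R j)%:R + 2 + d1%:R) :> R.
  by rewrite -!natrM -!natrD ler_nat.
have -> : (d1 + (2 * (N + m - 1) + So))%N%:R =
    d1%:R + 2 * N%:R + 2 * m%:R - 2 + So%:R :> R.
  apply: (addIr 2) => /=; rewrite -[LHS]natrD digit_sum_shift//.
  by rewrite !natrD ?natrM; ring.
have d0 : 0 <= d1%:R :> R by [].
move: hK; rewrite natrD natrM => hK.
have eN : 7 * (e1 * W) <= e * N%:R.
  have := ler_wpM2r W0 e1b; have := ler_wpM2l (ltW e0) N_ge; lra.
apply: le_trans eN; move: hA hB hM hK; rewrite !ler_norml.
move: (e1 * W) => w; lra.
Qed.

Lemma typical_limit (R : realType) (x : R) :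
  irr01 (1 - x) -> typical_digits R (fun i => gauss_seq (1 - x) i.+1) ->
  let m N := longest_excursion (@T_BCF R) N `[1 / 2, 1]%classic x in
  let d := bcf_digit x in
  (fun N : nat =>
     (N%:R)^-1 *
     ((\sum_(1 <= j < (N + m N).+1) d j)%N%:R -
      (maxn (2 * m N) (\max_(1 <= k < (N + m N).+1) d k))%:R))
    @ \oo --> (3 : R).
Proof.
move=> xi; pose z := gauss_map (1 - x).
have zi : irr01 z by exact: gauss_map_irr.
have -> : (fun i => gauss_seq (1 - x) i.+1) = gauss_seq z.
  by apply/funext => i; rewrite gauss_seqS.
set a := gauss_seq z => ta m d.
have a0 i : (0 < a i)%N by apply/gauss_digit_gt0/iter_gauss_irr.
have orb n j : (j < a n.*2)%N ->
    let v := iter (block_start a n + j).+1 (@T_BCF R) x in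
    bcf_first v = (if j.+1 == a n.*2 then (a n.*2.+1).+2 else 2%N) /\
    (`[1 / 2, 1]%classic v <-> j.+1 = a n.*2).
  by move=> jn; rewrite iterSr T_BCF_gauss//; exact: orbit_in_block.
apply/cvgrPdist_le => e e0.
have [N_ hN] := typical_balance (d 1%N) a0 ta e0.
exists N_.+1 => // N /= NN.
have [n0 hN0] := block_exists a0 N.
have mE := longest_excursionE a0 orb hN0; rewrite -/(m N) in mE.
have m0 : (0 < m N)%N := longest_block_gt0 a0 mE.
have [n1 hN1] := block_exists a0 (N + m N - 1).
have PE : (N + m N)%N = (N + m N - 1).+1 by lia.
have sumE : (\sum_(1 <= j < (N + m N).+1) d j)%N =
    (d 1 + (2 * (N + m N - 1) + \sum_(i < n1) a i.*2.+1))%N.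
  rewrite big_add1 /= big_mkord [in LHS]PE big_ord_recl; congr (_ + _)%N.
  by rewrite -(digit_sum a0 orb hN1).
have maxE : (\max_(1 <= k < (N + m N).+1) d k)%N =
    (\max_(k < (N + m N - 1).+1) d k.+1)%N.
  by rewrite big_add1 /= big_mkord -PE.
rewrite sumE maxE; set D := maxn _ _.
have := hN N (m N) n0 n1 D (ltnW NN) hN0 mE hN1 (leq_maxl _ _).
have D_att i : (i < n1)%N -> (a i.*2.+1 + 2 <= D)%N.
  move=> iN; have [t1 _] := andP hN1.
  have [u ut <-] := digit_attained a0 orb t1 iN.
  rewrite leq_max; apply/orP; right.
  have ut' : (u.+1 < (N + m N - 1).+1)%N by [].
  exact: (@bigop.leq_bigmax _ (fun k : 'I_(N + m N - 1).+1 => d k.+1)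
    (Ordinal ut')).
have D_le v : (forall i, (i < n1)%N -> (a i.*2.+1 <= v)%N) ->
    (D <= 2 * m N + (v + 2) + d 1%N)%N.
  move=> hv; rewrite geq_max -addnA leq_addr /=.
  apply/bigop.bigmax_leqP => -[[|k] kP] _ /=; first by rewrite addnA leq_addl.
  apply: (@leq_trans (v + 2)); first exact: (digit_le a0 orb hN1 hv).
  by rewrite addnCA leq_addr.
move=> /(_ D_att D_le) h.
have N0 : 0 < N%:R :> R by rewrite ltr0n (leq_trans _ NN).
rewrite distrC -(ler_pM2r N0) -[X in _ * X <= _](gtr0_norm N0) -normrM.
rewrite mulrBl mulrAC mulVf ?mul1r// gt_eqF//.
Qed.

Theorem theorem3p6 (R : realType) :
  let E : set R := `[1 / 2, 1]%classic in
  let m (N : nat) (x : R) : nat := longest_excursion (@T_BCF R) N E x in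
  {ae (@lebesgue_measure R), forall x : R, x \in `[0, 1] ->
    let d := bcf_digit x in
    is_bcf_expansion d x /\
    (fun N : nat =>
       (N%:R)^-1 *
       ((\sum_(1 <= j < (N + m N x).+1) d j)%N%:R -
        (maxn (2 * m N x) (\max_(1 <= k < (N + m N x).+1) d k))%:R))
      @ \oo --> (3 : R)}.
Proof.
move=> E m.
have rat0 : (@lebesgue_measure R).-negligible (@rational R).
  apply/negligible_outer_measure; apply: countable_lebesgue_measure0.
  by apply: card_le_trans (card_image_le _ _) _; exact: countableP.
apply: (@negligibleS _ _ _ (@lebesgue_measure R) _ _ _
  (@negligibleU _ _ _ (@lebesgue_measure R) _ _ rat0 (@atypical_negligible R))).
move=> x /= nP; apply: contrapT => nN; apply: nP => xE.
have xi : irrational x by move=> xr; apply: nN; left.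
have x01 : 0 < x < 1.
  move: xE; rewrite in_itv /= !le_eqVlt => /andP[/orP[/eqP x0|->]].
    by exfalso; apply: xi; exists 0 => //; rewrite rmorph0.
  move=> /orP[/eqP x1|-> //].
  by exfalso; apply: xi; exists 1 => //; rewrite rmorph1.
have yi : irr01 (1 - x).
  split; first by move: x01; lra.
  move=> [q _ qx]; apply: xi; exists (1 - q) => //.
  by rewrite rmorphB rmorph1 /= qx; ring.
split; first by apply: bcf_expansion; move: x01; lra.
apply: typical_limit => //.
by apply: contrapT => nt; apply: nN; right.
Qed.
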